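(* Let $c\in(0,\infty)$ and let $\psi$ satisfy $\log\psi(n)=c\lfloor\sqrt n\rfloor$ for all $n\ge1$. Let \[L(\psi)=\Big\{x\in(0,1)\setminus\mathbb{Q}:\ \lim_{n\to\infty}\frac{L_n(x)}{\psi(n)}=1\Big\},\qquad L_n(x)=\max_{1\le i\le n}\{a_i(x)a_{i+1}(x)\}.\] Then $\dim_{\mathrm H}L(\psi)=\theta(c)$, where $\theta(c)$ is the unique real solution of the equation $P(\theta)=c\left(\theta-\frac12\right)$.
   Context: Every irrational $x\in(0,1)$ has a unique infinite continued fraction expansion $x=[a_1(x),a_2(x),\ldots]$ with positive integer partial quotients $a_n(x)$. For positive integers $a_1,\dots,a_n$, $q_n=q_n(a_1,\dots,a_n)$ is defined by $q_{-1}=0$, $q_0=1$, $q_k=a_kq_{k-1}+q_{k-2}$ ($k\ge1$). The pressure function is $P(\theta):=\lim_{n\to\infty}\frac1n\log\sum_{a_1,\ldots,a_n\in\mathbb{N}}q_n^{-2\theta}(a_1,\ldots,a_n)$ for $\theta>1/2$; it is strictly decreasing, convex and real analytic on $(1/2,\infty)$. $\dim_{\mathrm H}$ denotes Hausdorff dimension. *)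

(* Defs.v *)
From HB Require Import structures.
From mathcomp Require Import all_boot all_order all_algebra.
From mathcomp Require Import all_classical all_reals all_analysis.

Set Implicit Arguments.
Unset Strict Implicit.
Unset Printing Implicit Defensive.

Import Order.TTheory GRing.Theory Num.Theory.
Import numFieldNormedType.Exports.

Local Open Scope classical_set_scope.
Local Open Scope ring_scope.

(* [a_1, ..., a_n] = 1 / (a_1 + 1 / (a_2 + ... + 1 / a_n)), and 0 for n = 0. *)
Fixpoint cf_value (R : realType) (s : seq nat) : R :=
  if s is a :: s' then (a%:R + cf_value R s')^-1 else 0.

(* The sequence a is indexed from 0: a 0 is the first partial quotient. *)
Definition cf_expansion (R : realType) (x : R) (a : nat -> nat) : Prop :=
  (forall n, (0 < a n)%N) /\ cf_value R (mkseq a n) @[n --> \oo] --> x.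

(* partial_quotient x i is a_{i+1}(x). An irrational x in (0,1) has exactly one
   expansion, so that the choice made by get is then harmless. *)
Definition partial_quotient (R : realType) (x : R) : nat -> nat :=
  get [set a : nat -> nat | cf_expansion x a].

Definition max_consecutive_product (R : realType) (x : R) (n : nat) : nat :=
  \max_(i < n) (partial_quotient x i * partial_quotient x i.+1)%N.

Definition L_set (R : realType) (psi : nat -> R) : set R :=
  [set x | [/\ 0 < x < 1, irrational x &
    (max_consecutive_product x n)%:R / psi n @[n --> \oo] --> (1 : R)]].

(* The pair (q_{k-1}, q_k) is threaded through a_1, ..., a_n, starting from
   (q_{-1}, q_0) = (0, 1). *)
Definition cf_denominator (s : seq nat) : nat :=
  (foldl (fun q a => (q.2, (a * q.2 + q.1)%N)) (0%N, 1%N) s).2.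

(* Only meaningful for theta > 1/2; the series diverges for smaller theta. *)
Definition pressure (R : realType) (theta : R) : \bar R :=
  limn (fun n : nat => (n%:R^-1)%:E *
    lne (\esum_(a in [set a : n.-tuple nat | forall i, (0 < tnth a i)%N])
           ((cf_denominator a)%:R `^ (- (2 * theta)))%:E))%E.

Definition diameter (R : realType) (U : set R) : \bar R :=
  ereal_sup [set `|x - y|%:E | x in U & y in U].

(* |U|^s with 0^0 = 1 for a singleton, and value 0 for the empty set even when
   s = 0 (so that finite covers are countable covers). *)
Definition diameter_pow (R : realType) (s : R) (U : set R) : \bar R :=
  if U == set0 then 0%E else poweR (diameter U) s.

Definition hausdorff_premeasure (R : realType) (s delta : R) (A : set R) :
    \bar R :=
  ereal_inf [set (\sum_(0 <= i <oo) diameter_pow s (U i))%E |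
    U in [set U : nat -> set R | A `<=` \bigcup_i U i /\
            forall i, (diameter (U i) <= delta%:E)%E]].

Definition hausdorff_measure (R : realType) (s : R) (A : set R) : \bar R :=
  ereal_sup [set hausdorff_premeasure s delta A | delta in [set d | 0 < d]].

Definition hausdorff_dim (R : realType) (A : set R) : \bar R :=
  ereal_inf [set s%:E | s in [set s | 0 <= s /\ hausdorff_measure s A = 0%E]].

(* Main.v *)
Require Import Defs.
From HB Require Import structures.
From mathcomp Require Import all_boot all_order all_algebra.
From mathcomp Require Import all_classical all_reals all_analysis.
From mathcomp Require Import zify ring lra.

Import Order.TTheory GRing.Theory Num.Theory.
Import numFieldNormedType.Exports.

Local Open Scope classical_set_scope.
Local Open Scope ring_scope.

(* Dimension is computed digit block by digit block. Since psi only jumps at the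
   squares n = k^2, by the factor e^c, a point x lies in L(psi) iff, up to a
   factor tending to 1, a_{k^2} a_{k^2+1} equals e^{ck} for all large k and no
   product between two squares exceeds the last such value. A block therefore
   consists of one pair of digits with product about e^{ck} and of about 2k free
   digits. With weights q^{-2s}, the free digits contribute e^{2k P(s)} and the
   pair contributes e^{ck} e^{-2s ck}, so that blocks are balanced exactly when
   P(s) = c (s - 1/2).

   For s above the root, the sums of q^{-2s} over blocks tend to 0 and cylinders
   give covers of arbitrarily small s-dimensional cost. For s below the root, we
   take the pairs to be (1, n) with n slightly larger than e^{ck}, let the free
   digits range over a finite alphabet, and weigh each block proportionally to
   q^{-2s}: the mass of a node of the resulting tree is then at most a constant
   times the s-th power of the distance of two points that separate there,
   because the sums over blocks beat the exponential losses within one block. *)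

(** * Continuants and Moebius maps *)

(** Continuants are only quasi-multiplicative, [q_u q_v <= q_(uv) <= 2 q_u q_v], so every
    concatenation may cost a factor [4^s] in the weights. For sums over all words this costs one
    bounded error in the logarithm, by Fekete's lemma. On the tree it is paid once per block, and
    block [k] adds a loss exponential in [k] when two points separate inside it. Passing from one
    level to the next thus costs a fixed factor, and below the root the block sums tend to infinity
    and absorb it. This is why the tree branches by whole blocks and not by digits.

    The large digit runs through the interval from [e^(ck)] to [e^(ck) (1 + 1/k)]: narrow enough for
    the limit in [L_set] to be 1, and still offering about [e^(ck) / k] choices. The lost factor
    [1/k] is harmless because the exponent is strictly below the root.

    No measure is constructed. A cover that is too cheap marks nodes of total mass less than 1, and
    a branch avoiding all of them is built by hand. The root itself comes from convexity of the
    pressure, which supplies the continuity needed for an intermediate value argument. *)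

Notation cf_step := (fun (q : nat * nat) (a : nat) => (q.2, (a * q.2 + q.1)%N)).

Definition cf_denominator_pred (s : seq nat) : nat :=
  (foldl cf_step (0%N, 1%N) s).1.

Section denominators.
Local Open Scope nat_scope.
Implicit Types (u v w : seq nat) (a c d : nat).

Lemma cf_denominator_rcons w a :
  cf_denominator (rcons w a) = a * cf_denominator w + cf_denominator_pred w.
Proof. by rewrite /cf_denominator -cats1 foldl_cat. Qed.

Lemma cf_denominator_pred_rcons w a :
  cf_denominator_pred (rcons w a) = cf_denominator w.
Proof. by rewrite /cf_denominator_pred -cats1 foldl_cat. Qed.

Lemma cf_denominator_pred_le w :
  all (leq 1) w -> cf_denominator_pred w <= cf_denominator w.
Proof.
elim/last_ind: w => // w a _; rewrite all_rcons => /andP[a0 _].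
by rewrite cf_denominator_pred_rcons cf_denominator_rcons; nia.
Qed.

Lemma cf_denominator_gt0 w : all (leq 1) w -> 0 < cf_denominator w.
Proof.
elim/last_ind: w => // w a IH; rewrite all_rcons => /andP[a0 /IH].
by rewrite cf_denominator_rcons; nia.
Qed.

Lemma cf_denominator_ge_size w : all (leq 1) w -> size w <= cf_denominator w.
Proof.
elim/last_ind: w => // w a IH; rewrite all_rcons => /andP[a0 pw].
rewrite cf_denominator_rcons size_rcons; have := IH pw.
case/lastP: w pw {IH} => [|w b] pw.
  by rewrite /cf_denominator /cf_denominator_pred /=; lia.
rewrite cf_denominator_pred_rcons.
by move: pw; rewrite all_rcons => /andP[_ /cf_denominator_gt0]; nia.
Qed.

(** The recursion is linear in its starting pair, with nonnegative coefficients, so a comparison of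
    starting pairs up to a constant persists. Both bounds for the continuant of a concatenation
    result from it. *)
Lemma foldl_cf_step_le v c d (x y x' y' : nat) :
  d * x <= c * x' -> d * y <= c * y' ->
  d * (foldl cf_step (x, y) v).2 <= c * (foldl cf_step (x', y') v).2.
Proof.
elim: v x y x' y' => [//|a v IH] x y x' y' h1 h2 /=; apply: IH => //=.
by rewrite !mulnDr !(mulnCA _ a); nia.
Qed.

Lemma cf_denominator_cat_ge u v :
  cf_denominator u * cf_denominator v <= cf_denominator (u ++ v).
Proof.
rewrite /cf_denominator foldl_cat; case: (foldl _ _ u) => x y /=.
by rewrite -[leqRHS]mul1n; apply: foldl_cf_step_le; lia.
Qed.

(** The start [(x, y)] left by [u] is not bounded by a multiple of [(0, 1)]. After the first digit
    [a] of [v] the pairs are [(y, a y + x)] and [(1, a)], and [x <= y <= a y] gives the factor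
    [2 y]. *)
Lemma cf_denominator_cat_le u v : all (leq 1) u -> all (leq 1) v ->
  cf_denominator (u ++ v) <= 2 * cf_denominator u * cf_denominator v.
Proof.
move=> pu; case: v => [|a v] /=.
  by move=> _; rewrite cats0 {3}/cf_denominator /= muln1 mul2n -addnn leq_addr.
move=> /andP[a0 _]; rewrite -[leqLHS]mul1n {1 3}/cf_denominator foldl_cat /=.
have := cf_denominator_pred_le _ pu.
rewrite /cf_denominator_pred /cf_denominator.
case: (foldl _ _ u) => x y /= xy.
by apply: foldl_cf_step_le; nia.
Qed.

Lemma cf_denominator_le_cat u v : all (leq 1) v ->
  cf_denominator u <= cf_denominator (u ++ v).
Proof.
move=> pv; apply: leq_trans (cf_denominator_cat_ge u v).
by have := cf_denominator_gt0 _ pv; nia.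
Qed.

Lemma digit_le_cf_denominator w a :
  all (leq 1) w -> a \in w -> a <= cf_denominator w.
Proof.
move=> pw /splitPr aw; case: aw pw => p1 p2; rewrite all_cat /= => /and3P[p1p a0 p2p].
apply: leq_trans (cf_denominator_cat_ge p1 (a :: p2)).
have := cf_denominator_cat_ge [:: a] p2; rewrite {1}/cf_denominator /=.
by have := cf_denominator_gt0 _ p1p; have := cf_denominator_gt0 _ p2p; nia.
Qed.

Lemma cf_denominator_le_expn w M :
  all (leq 1) w -> all (geq M) w -> cf_denominator w <= M.+1 ^ size w.
Proof.
elim/last_ind: w => // w a IH.
rewrite !all_rcons => /andP[a0 pw] /andP[/= aM wM].
rewrite cf_denominator_rcons size_rcons expnS.
have := IH pw wM; have := cf_denominator_pred_le _ pw.
move: (M.+1 ^ _) (cf_denominator w) (cf_denominator_pred w) => X Y Z; nia.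
Qed.

End denominators.

Section mobius.
Variable R : realType.
Implicit Types (w : seq nat) (t x y : R).

(** The inverse branch along [w] of the iterated Gauss map, that is, the Moebius map [t -> (p_n +
    p_(n-1) t) / (q_n + q_(n-1) t)]. *)
Fixpoint cf_tail w t : R :=
  if w is a :: w' then (a%:R + cf_tail w' t)^-1 else t.

Lemma cf_value_tail w : cf_value R w = cf_tail w 0.
Proof. by elim: w => //= a w ->. Qed.

Lemma cf_tail_cat u w t : cf_tail (u ++ w) t = cf_tail u (cf_tail w t).
Proof. by elim: u => //= a u ->. Qed.

Lemma cf_tail_itv w t : all (leq 1) w -> 0 <= t <= 1 -> 0 <= cf_tail w t <= 1.
Proof.
elim: w => //= a w IH /andP[a0 pw] /(IH pw) /andP[h1 h2].
have a1 : 1 <= a%:R :> R by rewrite ler1n.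
rewrite invr_ge0 invf_le1; lra.
Qed.

Lemma cf_mobius_den_gt0 w t : all (leq 1) w -> 0 <= t ->
  0 < (cf_denominator w)%:R + (cf_denominator_pred w)%:R * t.
Proof.
move=> pw t0; apply: ltr_pwDl; last by rewrite mulr_ge0.
by rewrite ltr0n cf_denominator_gt0.
Qed.

(** The Moebius map has determinant 1 or -1. Induction on the last digit gives the distance formula
    without introducing the numerators [p_n]. *)
Lemma cf_tail_dist w t t' : all (leq 1) w -> 0 <= t -> 0 <= t' ->
  `|cf_tail w t - cf_tail w t'| = `|t - t'| /
     (((cf_denominator w)%:R + (cf_denominator_pred w)%:R * t) *
      ((cf_denominator w)%:R + (cf_denominator_pred w)%:R * t')).
Proof.
elim/last_ind: w t t' => [|w a IH] t t' pw t0 t'0.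
  by rewrite /cf_denominator /cf_denominator_pred /= !mul0r !addr0 mulr1 divr1.
move: pw; rewrite all_rcons => /andP[a0 pw].
have a1 : 1 <= a%:R :> R by rewrite ler1n.
have at0 : 0 < a%:R + t by lra.
have at'0 : 0 < a%:R + t' by lra.
rewrite -cats1 !cf_tail_cat /= IH ?invr_ge0 ?ltW//.
rewrite cats1 cf_denominator_rcons cf_denominator_pred_rcons natrD natrM.
have -> : (a%:R + t)^-1 - (a%:R + t')^-1 = (t' - t) / ((a%:R + t) * (a%:R + t')).
  by field; rewrite !gt_eqF.
rewrite normrM normfV (gtr0_norm (mulr_gt0 at0 at'0)) distrC.
have := cf_mobius_den_gt0 _ _ pw (ltW at0).
have := cf_mobius_den_gt0 _ _ pw (ltW at'0).
set q := _%:R; set q' := _%:R => h1 h2; field.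
have q0 : 0 < q by rewrite ltr0n cf_denominator_gt0.
have q'0 : 0 <= q' by rewrite ler0n.
by rewrite !gt_eqF//=; nra.
Qed.

Lemma cf_tail_dist_le w t t' : all (leq 1) w -> 0 <= t <= 1 -> 0 <= t' <= 1 ->
  `|cf_tail w t - cf_tail w t'| <= (cf_denominator w)%:R ^- 2.
Proof.
move=> pw /andP[t0 t1] /andP[t'0 t'1]; rewrite cf_tail_dist//.
have q0 : 0 < (cf_denominator w)%:R :> R by rewrite ltr0n cf_denominator_gt0.
have q'0 : 0 <= (cf_denominator_pred w)%:R :> R by rewrite ler0n.
rewrite ler_pdivrMr; last by rewrite mulr_gt0// cf_mobius_den_gt0.
rewrite mulrC ler_pdivlMr ?exprn_gt0//.
move: q0 q'0; set q := _%:R; set q' := _%:R => q0 q'0.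
have : `|t - t'| <= 1 by rewrite ler_norml; lra.
have : 0 <= q' * t by rewrite mulr_ge0.
have : 0 <= q' * t' by rewrite mulr_ge0.
have : 0 <= `|t - t'| by [].
rewrite expr2; nra.
Qed.

Lemma cf_tail_dist_ge w t t' : all (leq 1) w -> 0 <= t <= 1 -> 0 <= t' <= 1 ->
  `|t - t'| <= 4 * (cf_denominator w)%:R ^+ 2 * `|cf_tail w t - cf_tail w t'|.
Proof.
move=> pw /andP[t0 t1] /andP[t'0 t'1]; rewrite cf_tail_dist//.
have q0 : 0 < (cf_denominator w)%:R :> R by rewrite ltr0n cf_denominator_gt0.
have q'q : (cf_denominator_pred w)%:R <= (cf_denominator w)%:R :> R.
  by rewrite ler_nat cf_denominator_pred_le.
have q'0 : 0 <= (cf_denominator_pred w)%:R :> R by rewrite ler0n.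
rewrite mulrA ler_pdivlMr; last by rewrite mulr_gt0// cf_mobius_den_gt0.
move: q0 q'0 q'q; set q := _%:R; set q' := _%:R => q0 q'0 q'q.
rewrite mulrC ler_wpM2r//.
have : q + q' * t <= 2 * q by nra.
have : q + q' * t' <= 2 * q by nra.
have : 0 <= q' * t by rewrite mulr_ge0.
have : 0 <= q' * t' by rewrite mulr_ge0.
rewrite expr2; nra.
Qed.

End mobius.
Arguments cf_tail {R}.

(** * Continued fraction expansions *)

Section expansions.
Variable R : realType.
Implicit Types (w : seq nat) (t x y : R) (a b : nat -> nat).

Lemma mkseq_pos a n : (forall i, 0 < a i)%N -> all (leq 1) (mkseq a n).
Proof. by move=> a0; apply/allP => _ /mapP[i _ ->]; exact: a0. Qed.

Lemma mkseqD T (f : nat -> T) n m :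
  mkseq f (n + m) = mkseq f n ++ mkseq (fun i => f (n + i)%N) m.
Proof. by rewrite /mkseq iotaD map_cat add0n -[X in iota X m]addn0 iotaDl -map_comp. Qed.

Lemma cf_value_itv w : all (leq 1) w -> 0 <= cf_value R w <= 1.
Proof. by move=> pw; rewrite cf_value_tail cf_tail_itv// lexx ler01. Qed.

Lemma cf_denominator_sqrV_lt w e : all (leq 1) w -> 0 < e ->
  e^-1 < (size w)%:R -> (cf_denominator w)%:R ^- 2 < e :> R.
Proof.
move=> pw e0 we.
have w0 : 0 < (size w)%:R :> R by rewrite (lt_trans _ we)// invr_gt0.
have qw : (size w)%:R <= (cf_denominator w)%:R :> R.
  by rewrite ler_nat cf_denominator_ge_size.
have q1 : 1 <= (cf_denominator w)%:R :> R by rewrite ler1n cf_denominator_gt0.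
rewrite invf_plt ?posrE ?exprn_gt0//; last by lra.
by apply: (lt_le_trans we); rewrite expr2; nra.
Qed.

Lemma cf_expansion_exists a : (forall i, 0 < a i)%N ->
  exists x : R, cf_expansion x a.
Proof.
move=> a0; suff /cauchy_cvgP : cauchy (cf_value R (mkseq a n) @[n --> \oo]).
  by move=> /cvg_ex[x ax]; exists x.
apply/cauchyP => e e0.
have [N Ne] : exists N, e^-1 < N%:R.
  by exists (Num.truncn e^-1).+1; exact: truncnS_gt.
exists (cf_value R (mkseq a N)); exists N => // n /= Nn.
rewrite /ball /= -(subnKC Nn) mkseqD !cf_value_tail cf_tail_cat.
apply: (@le_lt_trans _ _ ((cf_denominator (mkseq a N))%:R ^- 2)); last first.
  by apply: cf_denominator_sqrV_lt; rewrite ?size_mkseq// mkseq_pos.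
apply: cf_tail_dist_le; rewrite ?mkseq_pos ?lexx ?ler01//.
by rewrite cf_tail_itv ?lexx ?ler01// mkseq_pos.
Qed.

Lemma cf_tail_ge0 w t : 0 <= t -> 0 <= cf_tail w t.
Proof. by elim: w => //= a w IH t0; rewrite invr_ge0 addr_ge0// IH. Qed.

Lemma cf_expansion_itv_closed x a : cf_expansion x a -> 0 <= x <= 1.
Proof.
move=> [a0 ax]; have vn n := cf_value_itv _ (mkseq_pos a n a0).
by apply/andP; split; [apply: (cvgr_to_ge ax)|apply: (cvgr_to_le ax)];
  apply: nearW => n; case/andP: (vn n).
Qed.

Lemma cvg_cf_tail w (u : nat -> R) y : all (leq 1) w -> 0 <= y ->
  u n @[n --> \oo] --> y -> cf_tail w (u n) @[n --> \oo] --> cf_tail w y.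
Proof.
move=> + y0 uy; elim: w => //= a w IH /andP[a0 pw].
apply: cvgV; last by apply: cvgD; [exact: cvg_cst|exact: IH].
by rewrite gt_eqF// ltr_pwDl ?ltr0n// cf_tail_ge0.
Qed.

Lemma cf_expansion_tail x a n : cf_expansion x a ->
  exists2 y, cf_expansion y (fun i => a (n + i)%N) & x = cf_tail (mkseq a n) y.
Proof.
move=> [a0 ax].
have [y yE] := cf_expansion_exists (fun i => a (n + i)%N) (fun i => a0 (n + i)%N).
exists y => //.
have H1 : cf_value R (mkseq a (m + n)%N) @[m --> \oo] --> x.
  by rewrite (cvg_shiftn n (fun m => cf_value R (mkseq a m))).
suff H2 : cf_value R (mkseq a (m + n)%N) @[m --> \oo] --> cf_tail (mkseq a n) y.
  exact: (cvg_unique (@Rhausdorff R) H1 H2).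
have : cf_tail (mkseq a n) (cf_value R (mkseq (fun i => a (n + i)%N) m))
         @[m --> \oo] --> cf_tail (mkseq a n) y.
  apply: cvg_cf_tail; first exact: mkseq_pos.
    by case/andP: (cf_expansion_itv_closed _ _ yE).
  by case: yE.
apply: cvg_trans; apply: near_eq_cvg; apply: nearW => m /=.
by rewrite addnC mkseqD !cf_value_tail cf_tail_cat.
Qed.

Lemma cf_expansion_behead x a : cf_expansion x a ->
  exists2 y, cf_expansion y (fun i => a i.+1) & x = ((a 0%N)%:R + y)^-1.
Proof. by move=> /(cf_expansion_tail _ _ 1)[y yE ->]; exists y. Qed.

(** Positivity comes first, from the closed bound on the tail; positivity of the tail then gives
    [x < 1], even if the first digit is 1. *)
Lemma cf_expansion_itv x a : cf_expansion x a -> 0 < x < 1.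
Proof.
have gt0 (z : R) b : cf_expansion z b -> 0 < z.
  move=> zb; have [y /cf_expansion_itv_closed/andP[y0 _] ->] := cf_expansion_behead _ _ zb.
  by rewrite invr_gt0 ltr_pwDl// ltr0n; case: zb.
move=> xa; rewrite (gt0 _ _ xa)/=.
have [y /gt0 y0 ->] := cf_expansion_behead _ _ xa.
have a1 : 1 <= (a 0%N)%:R :> R by rewrite ler1n; case: xa.
by rewrite invf_lt1; lra.
Qed.

Lemma cf_expansion_head x y a b :
  cf_expansion x (fun i => a i.+1) -> cf_expansion y (fun i => b i.+1) ->
  (a 0%N)%:R + x = (b 0%N)%:R + y -> a 0%N = b 0%N.
Proof.
move=> /cf_expansion_itv xI /cf_expansion_itv yI e.
have [ab|ba|//] := ltngtP (a 0%N) (b 0%N).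
- exfalso; move: ab; rewrite -(ler_nat R) -natr1; lra.
- exfalso; move: ba; rewrite -(ler_nat R) -natr1; lra.
Qed.

Lemma cf_expansion_inj x a b : cf_expansion x a -> cf_expansion x b -> a = b.
Proof.
move=> xa xb; apply/funext => n.
elim: n x a b xa xb => [|n IH] x a b xa xb; have [y ya xy] := cf_expansion_behead _ _ xa;
  have [z zb xz] := cf_expansion_behead _ _ xb;
  have e : (a 0%N)%:R + y = (b 0%N)%:R + z by apply: invr_inj; rewrite -xy -xz.
  exact: cf_expansion_head ya zb e.
apply: (IH y (fun i => a i.+1) (fun i => b i.+1)) => //; suff -> : y = z by [].
by have := e; rewrite (cf_expansion_head _ _ _ _ ya zb e) => /addrI.
Qed.

(** Descent on the denominator: if [x = m / b], the tail is [(b - a_0 m) / m], and [m < b] since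
    [x < 1]. *)
Lemma cf_expansion_irrational x a : cf_expansion x a -> irrational x.
Proof.
move=> xa /rationalP[i [b xE]].
elim/ltn_ind: b x a i xa xE => b IH x a i xa xE.
have /andP[x0 x1] := cf_expansion_itv _ _ xa.
have [y ya xy] := cf_expansion_behead _ _ xa.
have b0 : 0 < b%:R :> R.
  by rewrite lt0r ler0n andbT; apply: contraTN x0 => /eqP b0; rewrite xE b0 invr0 mulr0 ltxx.
have i0 : 0 < i%:~R :> R by rewrite -(pmulr_lgt0 _ (_ : 0 < b%:R^-1)) ?invr_gt0// -xE.
have ib : i%:~R < b%:R :> R by move: x1; rewrite xE ltr_pdivrMr// mul1r.
case: i xE i0 ib => m xE i0 ib; last by move: i0; rewrite ltr0z.
rewrite -pmulrn in xE i0 ib.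
apply: (IH m _ y _ (b%:Z - ((a 0%N) * m)%N%:Z) ya); first by rewrite -(ltr_nat R).
have -> : y = x^-1 - (a 0%N)%:R by rewrite xy invrK; ring.
rewrite xE rmorphB /= -!pmulrn natrM; field.
by rewrite !gt_eqF.
Qed.

Lemma rational_mobius (n : nat) y : rational y -> rational ((n%:R + y)^-1).
Proof.
by move=> [q _ <-]; exists ((n%:R + q)^-1) => //; rewrite fmorphV rmorphD /= ratr_nat.
Qed.

Lemma irrational_cf_expansion x : 0 < x < 1 -> irrational x ->
  exists a, cf_expansion x a.
Proof.
move=> x01 irx.
(* The digits are read off the orbit of the Gauss map; irrationality keeps the orbit from reaching
   0. *)
pose gauss (y : R) := y^-1 - (Num.truncn y^-1)%:R.
pose xs n := iter n gauss x.
pose a n := Num.truncn (xs n)^-1.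
have xsP n : 0 < xs n < 1 /\ irrational (xs n).
  elim: n => [//|n [/andP[y0 y1] iry]]; rewrite /xs iterS -/(xs n).
  have yV0 : 0 <= (xs n)^-1 by rewrite invr_ge0 ltW.
  have /andP[t1 t2] := truncn_itv yV0.
  have yE : xs n = ((Num.truncn (xs n)^-1)%:R + gauss (xs n))^-1.
    by rewrite /gauss addrC subrK invrK.
  have irg : irrational (gauss (xs n)).
    by move=> rg; apply: iry; rewrite yE; exact: rational_mobius.
  split=> //; rewrite lt_neqAle /gauss subr_ge0 t1 ltrBlDr [1 + _]addrC natr1 t2 !andbT.
  apply/negP => /eqP g0; apply: irg; exists 0 => //.
  by rewrite /gauss -g0 rmorph0.
have apos n : (0 < a n)%N.
  have [/andP[y0 y1] _] := xsP n.
  by rewrite truncn_gt0 invf_ge1// ltW.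
have xE n : x = cf_tail (mkseq a n) (xs n).
  elim: n => [//|n IH]; rewrite -addn1 mkseqD cf_tail_cat [LHS]IH /=.
  by rewrite /xs addn1 iterS -/(xs n) addn0 /gauss addrC subrK invrK.
exists a; split => //; apply/cvgrPdist_lt => e e0.
near=> n; rewrite [X in `|X - _|](xE n) cf_value_tail.
have [/andP[y0 y1] _] := xsP n.
apply: (@le_lt_trans _ _ ((cf_denominator (mkseq a n))%:R ^- 2)).
  by apply: cf_tail_dist_le; rewrite ?mkseq_pos// ?lexx ?ler01 ?(ltW y0) ?ltW.
apply: cf_denominator_sqrV_lt; rewrite ?mkseq_pos// size_mkseq; near: n.
exact: nbhs_infty_gtr.
Unshelve. all: by end_near. Qed.

Lemma partial_quotientP x a : cf_expansion x a -> partial_quotient x = a.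
Proof.
move=> xa; apply: (cf_expansion_inj x) => //; rewrite /partial_quotient.
by apply: (@getPex _ [set a : nat -> nat | cf_expansion x a]); exists a.
Qed.

(** Different first digits alone do not separate [x] and [y], since the tail [xi] of the point with
    the smaller digit may be close to 1. Its next two digits prevent this:
    [1 - xi >= xi1 / 2 >= 1 / (4 D)]. The denominators contribute [(2 D)^2], hence [16 D^3]. *)
Lemma cf_expansion_dist_head x y a b (D : nat) :
  cf_expansion x a -> cf_expansion y b -> a 0%N <> b 0%N ->
  (forall i, i < 3 -> a i <= D)%N -> (forall i, i < 3 -> b i <= D)%N ->
  1 <= 16 * D%:R ^+ 3 * `|x - y|.
Proof.
move=> xa yb ab.
wlog {ab} ab : x y a b xa yb / (a 0%N < b 0%N)%N.
  move=> H aD bD; have [h|h|//] := ltngtP (a 0%N) (b 0%N); first exact: (H x y a b).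
  by rewrite distrC; exact: (H y x b a).
move=> aD bD.
have [xi xia ->] := cf_expansion_behead _ _ xa.
have [eta etab ->] := cf_expansion_behead _ _ yb.
have [xi1 xi1a xiE] := cf_expansion_behead _ _ xia.
have [xi2 xi2a xi1E] := cf_expansion_behead _ _ xi1a.
have /andP[xi0 xi1'] := cf_expansion_itv _ _ xia.
have /andP[eta0 eta1] := cf_expansion_itv _ _ etab.
have /andP[xi10 xi11] := cf_expansion_itv _ _ xi1a.
have /andP[xi20 xi21] := cf_expansion_itv _ _ xi2a.
have a1 i : 1 <= (a i)%:R :> R by rewrite ler1n; case: xa.
have b1 : 1 <= (b 0%N)%:R :> R by rewrite ler1n; case: yb.
have aD' i : (i < 3)%N -> (a i)%:R <= D%:R :> R by move=> /aD; rewrite ler_nat.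
have bD' : (b 0%N)%:R <= D%:R :> R by rewrite ler_nat bD.
have ab' : (a 0%N)%:R + 1 <= (b 0%N)%:R :> R by rewrite natr1 ler_nat.
have D1 : 1 <= D%:R :> R by apply: le_trans b1 _.
have xi1lb : (2 * D%:R)^-1 <= xi1.
  by rewrite xi1E lef_pV2 ?posrE; have := aD' 2%N isT; have := a1 2%N; lra.
have xilb : xi1 / 2 <= 1 - xi.
  rewrite xiE -subr_ge0.
  have -> : 1 - ((a 1%N)%:R + xi1)^-1 - xi1 / 2 =
     (2 * ((a 1%N)%:R + xi1 - 1) - xi1 * ((a 1%N)%:R + xi1)) / (2 * ((a 1%N)%:R + xi1)).
    by field; rewrite gt_eqF//; have := a1 1%N; lra.
  by apply: divr_ge0; have := a1 1%N; nra.
have -> : ((a 0%N)%:R + xi)^-1 - ((b 0%N)%:R + eta)^-1 =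
    ((b 0%N)%:R - (a 0%N)%:R + eta - xi) / (((a 0%N)%:R + xi) * ((b 0%N)%:R + eta)).
  by field; rewrite !gt_eqF//; have := a1 0%N; lra.
have dx0 : 0 < (a 0%N)%:R + xi by have := a1 0%N; lra.
have dy0 : 0 < (b 0%N)%:R + eta by lra.
rewrite normrM normfV (gtr0_norm (mulr_gt0 dx0 dy0)) ger0_norm; last by lra.
rewrite mulrA ler_pdivlMr ?mulr_gt0// mul1r.
have : ((a 0%N)%:R + xi) * ((b 0%N)%:R + eta) <= (2 * D%:R) * (2 * D%:R).
  by apply: ler_pM; rewrite ?ltW//; have := aD' 0%N isT; lra.
move/le_trans; apply.
have h : (4 * D%:R)^-1 <= (b 0%N)%:R - (a 0%N)%:R + eta - xi.
  apply: (@le_trans _ _ (1 - xi)); last lra.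
  apply: le_trans xilb; rewrite ler_pdivlMr//; apply: le_trans xi1lb.
  by rewrite le_eqVlt; apply/orP; left; apply/eqP; field; rewrite gt_eqF//; lra.
have -> : 2 * D%:R * (2 * D%:R) = 16 * D%:R ^+ 3 * (4 * D%:R)^-1 :> R.
  by field; rewrite gt_eqF//; lra.
by rewrite ler_wpM2l// mulr_ge0// exprn_ge0.
Qed.

End expansions.

(** * Sums of q^(-2s) over sets of words *)

Section esum_extra.
Variables (R : realType).
Local Open Scope ereal_scope.

Lemma esum_subset (T : choiceType) (A B : set T) (f : T -> \bar R) :
  A `<=` B -> \esum_(i in A) f i <= \esum_(i in B) f i.
Proof.
move=> AB; apply: ereal_sup_le => _ [X [finX XA] <-]; exists X => //.
by split => //; exact: subset_trans AB.
Qed.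

Lemma esum_inj_le (T T' : choiceType) (A : set T) (B : set T') (e : T -> T')
    (f : T -> \bar R) (g : T' -> \bar R) :
  set_inj A e -> (forall x, A x -> B (e x) /\ f x <= g (e x)) ->
  \esum_(x in A) f x <= \esum_(y in B) g y.
Proof.
move=> einj H; apply: (@le_trans _ _ (\esum_(x in A) g (e x))).
  by apply: le_esum => x /H[].
rewrite -esum_image//; apply: esum_subset => _ [x /H[Bx _] <-].
exact: Bx.
Qed.

Lemma esum_mull_le (T : choiceType) (A : set T) (c : R) (f : T -> \bar R) :
  (0 <= c)%R -> (forall i, 0 <= f i) ->
  \esum_(i in A) (c%:E * f i) <= c%:E * \esum_(i in A) f i.
Proof.
move=> c0 f0; apply: ge_ereal_sup => _ [X [finX XA] <-].
rewrite -ge0_mule_fsumr// lee_wpmul2l ?lee_fin//.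
by apply: ereal_sup_ubound; exists X.
Qed.

Lemma esum_mull (T : choiceType) (A : set T) (c : R) (f : T -> \bar R) :
  (0 < c)%R -> (forall i, 0 <= f i) ->
  \esum_(i in A) (c%:E * f i) = c%:E * \esum_(i in A) f i.
Proof.
move=> c0 f0; apply/le_anti; rewrite (esum_mull_le _ _ _ _ (ltW c0) f0) /=.
have : \esum_(i in A) (c^-1%:E * (c%:E * f i)) <= c^-1%:E * \esum_(i in A) (c%:E * f i).
  apply: esum_mull_le => [|i]; first by rewrite invr_ge0 ltW.
  by rewrite mule_ge0// lee_fin ltW.
rewrite (_ : \esum_(i in A) _ = \esum_(i in A) f i); last first.
  by apply: eq_esum => i _; rewrite muleA -EFinM mulVf ?gt_eqF// mul1e.
have c0e : 0 <= c%:E by rewrite lee_fin ltW.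
move=> /(lee_wpmul2l c0e) H; apply: (le_trans H).
by rewrite muleA -EFinM mulfV ?gt_eqF// mul1e.
Qed.

End esum_extra.

Section word_sums.
Variable R : realType.
Implicit Types (s t : R) (A B : set (seq nat)) (u v w : seq nat).

Definition words (n : nat) : set (seq nat) :=
  [set w | all (leq 1) w /\ size w = n].

(** Up to constants depending on [s], the [s]-th power of the length of the cylinder of [w]. *)
Definition weight s w : R := (cf_denominator w)%:R `^ (- (2 * s)).

Definition word_sum s A : \bar R := \esum_(w in A) (weight s w)%:E.

Definition cat_set A B : set (seq nat) := [set u ++ v | u in A & v in B].

Lemma weight_ge0 s w : 0 <= weight s w.
Proof. exact: powR_ge0. Qed.

Lemma weight_fin_ge0 s w : (0 <= (weight s w)%:E)%E.
Proof. by rewrite lee_fin weight_ge0. Qed.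

Lemma weight_gt0 s w : all (leq 1) w -> 0 < weight s w.
Proof. by move=> pw; rewrite powR_gt0// ltr0n cf_denominator_gt0. Qed.

Lemma weight_nil s : weight s [::] = 1.
Proof. by rewrite /weight /cf_denominator /= powR1. Qed.

Lemma natr_powRN_le s (m n : nat) : 0 <= s -> (0 < m)%N -> (m <= n)%N ->
  n%:R `^ (- (2 * s)) <= m%:R `^ (- (2 * s)) :> R.
Proof.
move=> s0 m0 mn; have n0 := leq_trans m0 mn.
rewrite !powRN lef_pV2 ?posrE ?powR_gt0 ?ltr0n//.
by apply: ge0_ler_powR; rewrite ?mulr_ge0// ?nnegrE ?ler_nat.
Qed.

Lemma weight_cat_le s u v : 0 <= s -> all (leq 1) u -> all (leq 1) v ->
  weight s (u ++ v) <= weight s u * weight s v.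
Proof.
move=> s0 pu pv; rewrite /weight -powRM// -natrM; apply: natr_powRN_le => //.
  by rewrite muln_gt0 !cf_denominator_gt0.
exact: cf_denominator_cat_ge.
Qed.

Lemma weight_cat_ge s u v : 0 <= s -> all (leq 1) u -> all (leq 1) v ->
  weight s u * weight s v <= 4 `^ s * weight s (u ++ v).
Proof.
move=> s0 pu pv.
have -> : 4 `^ s = (2%:R `^ (- (2 * s)))^-1 :> R.
  by rewrite -powRN opprK powRrM powR_mulrn// -natrX.
rewrite ler_pdivlMl ?powR_gt0// /weight -!powRM ?mulr_ge0//.
rewrite -!natrM; apply: natr_powRN_le => //.
  by rewrite cf_denominator_gt0// all_cat pu.
by rewrite mulnA; exact: cf_denominator_cat_le.
Qed.

Lemma word_sum_ge0 s A : (0 <= word_sum s A)%E.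
Proof. by apply: esum_ge0 => w _; rewrite lee_fin weight_ge0. Qed.

Lemma word_sum_subset s A B : A `<=` B -> (word_sum s A <= word_sum s B)%E.
Proof. exact: esum_subset. Qed.

(** A word may split in several ways, which does no harm to an upper bound: choosing one splitting
    per word injects [cat_set A B] into the pairs. *)
Lemma word_sum_cat s A B (a b : R) : 0 <= s ->
  (forall w, A w -> all (leq 1) w) -> (forall w, B w -> all (leq 1) w) ->
  (word_sum s A <= a%:E -> word_sum s B <= b%:E ->
   word_sum s (cat_set A B) <= (a * b)%:E)%E.
Proof.
move=> s0 pA pB Aa Bb.
have a0 : 0 <= a by rewrite -lee_fin; apply: le_trans Aa; exact: word_sum_ge0.
have b0 : 0 <= b by rewrite -lee_fin; apply: le_trans Bb; exact: word_sum_ge0.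
have /choice[e eP] : forall w, exists p : seq nat * seq nat,
    cat_set A B w -> [/\ A p.1, B p.2 & p.1 ++ p.2 = w].
  move=> w; have [[u Au [v Bv <-]]|nw] := pselect (cat_set A B w).
    by exists (u, v).
  by exists ([::], [::]).
apply: (@le_trans _ _
  (\esum_(p in A `*`` (fun=> B)) ((weight s p.1)%:E * (weight s p.2)%:E))%E).
  apply: (@esum_inj_le _ _ _ _ _ e) => [x y|w ABw].
    by rewrite !inE => /eP[_ _ xE] /eP[_ _ yE] exy; rewrite -xE -yE exy.
  have [Au Bv wE] := eP _ ABw; split => //.
  by have := weight_cat_le _ _ _ s0 (pA _ Au) (pB _ Bv); rewrite wE -EFinM lee_fin.
rewrite -(@esum_esum _ _ _ A (fun=> B) (fun u v => (weight s u)%:E * (weight s v)%:E)%E); last first.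
  by move=> u v _ _; rewrite -EFinM lee_fin mulr_ge0 ?weight_ge0.
apply: (@le_trans _ _ (\esum_(u in A) (b%:E * (weight s u)%:E))%E).
  apply: le_esum => u _; rewrite muleC.
  apply: (le_trans (esum_mull_le _ _ _ _ _ (weight_ge0 s u) (weight_fin_ge0 s))).
  by apply: lee_wpmul2l => //; rewrite lee_fin weight_ge0.
apply: (le_trans (esum_mull_le _ _ _ _ _ b0 (weight_fin_ge0 s))).
by rewrite mulrC EFinM; apply: lee_wpmul2l; rewrite ?lee_fin.
Qed.

(** For the lower bound splittings must be unique, which holds because the words of [A] have a
    common length. *)
Lemma word_sum_cat_ge s A B n : 0 <= s -> A `<=` words n ->
  (forall w, B w -> all (leq 1) w) -> (0 < word_sum s B)%E ->
  (word_sum s B < +oo -> word_sum s A * word_sum s B <=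
    (4 `^ s)%:E * word_sum s (cat_set A B))%E.
Proof.
move=> s0 An pB B0 Boo.
have Bfin : word_sum s B \is a fin_num by rewrite ge0_fin_numE// word_sum_ge0.
rewrite /word_sum -esum_mull ?powR_gt0//; last by move=> i; rewrite lee_fin weight_ge0.
apply: (@le_trans _ _
  (\esum_(p in A `*`` (fun=> B)) ((weight s p.1)%:E * (weight s p.2)%:E))%E).
  rewrite -(@esum_esum _ _ _ A (fun=> B) (fun u v => (weight s u)%:E * (weight s v)%:E)%E); last first.
    by move=> u v _ _; rewrite -EFinM lee_fin mulr_ge0 ?weight_ge0.
  rewrite -/(word_sum s B) -(fineK Bfin) muleC -esum_mull; last 2 first.
  - by rewrite fine_gt0// B0 Boo.
  - by move=> i; rewrite lee_fin weight_ge0.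
  apply: le_esum => u Au; rewrite (fineK Bfin) muleC esum_mull//.
    by apply: weight_gt0; have [] := An _ Au.
  by move=> v; rewrite lee_fin weight_ge0.
apply: (@esum_inj_le _ _ _ _ _ (fun p => p.1 ++ p.2)) => [[u v] [u' v']|[u v]].
  rewrite !inE => -[/= /An[_ su] _] [/= /An[_ su'] _] /eqP.
  by rewrite eqseq_cat ?su ?su'// => /andP[/eqP -> /eqP ->].
move=> [/= Au Bv]; split; first by exists u => //; exists v.
rewrite -!EFinM lee_fin; apply: weight_cat_ge => //; last exact: pB.
by have [] := An _ Au.
Qed.

End word_sums.

(** * The pressure as the slope of a quasi-linear sequence *)

Section power_sums.
Variable R : realType.
Implicit Types (r s x y : R).

(** The convex function [y^(-r)] lies above its tangent at [x]. At consecutive integers this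
    replaces the comparison of a series with an integral. *)
Lemma powRN_tangent r x y : 0 <= r -> 0 < x -> 0 < y ->
  x `^ (- r) - r * (y - x) * x `^ (- (1 + r)) <= y `^ (- r).
Proof.
move=> r0 x0 y0.
have -> : x `^ (- (1 + r)) = x `^ (- r) / x.
  by rewrite opprD powRD ?(gt_eqF x0) ?implybT// powR_inv1 ?ltW// mulrC.
have -> : y = x * (y / x) by field; rewrite gt_eqF.
have yx0 : 0 < y / x by rewrite divr_gt0.
rewrite [leRHS](powRM _ (ltW x0) (ltW yx0)).
have -> : x `^ (- r) - r * (x * (y / x) - x) * (x `^ (- r) / x) =
    x `^ (- r) * (1 - r * (y / x - 1)) by field; rewrite gt_eqF.
rewrite ler_wpM2l ?powR_ge0//.
rewrite [in leRHS]/powR gt_eqF//.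
apply: le_trans (expR_ge1Dx _); rewrite mulNr lerD2l lerN2 ler_wpM2l//.
by have := @le_ln1Dx R (y / x - 1); rewrite (addrC 1 (_ - 1)) subrK; apply; lra.
Qed.

Lemma sum_powR_le r M : 0 < r ->
  \sum_(i < M) (i.+1)%:R `^ (- (1 + r)) <= 1 + r^-1.
Proof.
move=> r0; have rV : 0 < r^-1 by rewrite invr_gt0.
case: M => [|M]; first by rewrite big_ord0; lra.
(* The remainder is kept so that the tangent inequality pays for each new term. *)
suff : \sum_(i < M.+1) (i.+1)%:R `^ (- (1 + r)) <= 1 + r^-1 * (1 - (M.+1)%:R `^ (- r)).
  move/le_trans; apply; rewrite lerD2l ler_piMr ?(ltW rV)//.
elim: M => [|M IH].
  by rewrite big_ord1 !powR1 subrr mulr0 addr0.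
rewrite big_ord_recr /=; apply: (le_trans (lerD IH (lexx _))).
have M0 : 0 < (M.+1)%:R :> R by rewrite ltr0n.
have := @powRN_tangent r (M.+2)%:R (M.+1)%:R (ltW r0).
rewrite !ltr0n => /(_ isT isT).
rewrite -[(M.+2)%:R]natr1.
set A := _ `^ (- r); set B := _ `^ (- (1 + r)); set C := _ `^ (- r) => h.
rewrite -addrA lerD2l -(ler_pM2l r0) mulrDr !mulrA mulfV ?gt_eqF// !mul1r.
lra.
Qed.

Lemma sum_powR_ge r M : 0 < r ->
  r^-1 * (1 - (M.+1)%:R `^ (- r)) <= \sum_(i < M) (i.+1)%:R `^ (- (1 + r)).
Proof.
move=> r0; elim: M => [|M IH]; first by rewrite big_ord0 powR1 subrr mulr0.
rewrite big_ord_recr /=; apply: (le_trans _ (lerD IH (lexx _))).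
have := @powRN_tangent r (M.+1)%:R (M.+2)%:R (ltW r0).
rewrite !ltr0n => /(_ isT isT).
rewrite -[(M.+2)%:R]natr1.
set A := _ `^ (- r); set B := _ `^ (- (1 + r)); set C := _ `^ (- r) => h.
have : r^-1 * (A - C) <= B by rewrite ler_pdivrMl//; lra.
lra.
Qed.

End power_sums.

Section quasi_linear.
Variable R : realType.

(* Fekete's lemma; superadditivity up to a constant also gives the rate. *)
Lemma quasi_linear_slope (u : nat -> R) (C : R) :
  (forall n m, u (n + m)%N <= u n + u m) ->
  (forall n m, u n + u m <= C + u (n + m)%N) ->
  exists l, forall n, n%:R * l <= u n <= n%:R * l + C.
Proof.
move=> usub usup.
have uk_le n k : u (k.+1 * n)%N <= k.+1%:R * u n.
  elim: k => [|k IH]; first by rewrite mul1n mul1r.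
  rewrite mulSn; apply: (le_trans (usub _ _)).
  by rewrite -[(k.+2)%:R]natr1; lra.
have uk_ge n k : k.+1%:R * (u n - C) <= u (k.+1 * n)%N - C.
  elim: k => [|k IH]; first by rewrite mul1n mul1r.
  rewrite [(k.+2 * n)%N]mulSn; have := usup n (k.+1 * n)%N.
  by rewrite -[(k.+2)%:R]natr1; lra.
(* Every lower quotient [(u n - C) / n] is at most every upper quotient [u m / m], as both are
   compared through [u (n m)]. The slope is the supremum of the lower ones. *)
pose E := [set (u n.+1 - C) / (n.+1)%:R | n in [set: nat]].
have C0 : 0 <= C by have := usub 0%N 0%N; have := usup 0%N 0%N; rewrite addn0; lra.
have Eub m : ubound E (u m.+1 / (m.+1)%:R).
  move=> _ [n _ <-].
  rewrite ler_pdivrMr ?ltr0n// mulrAC ler_pdivlMr ?ltr0n//.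
  by have := uk_le m.+1 n; have := uk_ge n.+1 m; rewrite mulnC; lra.
have supE : has_sup E.
  by split; [exists ((u 1 - C) / 1); exists 0%N|exists (u 1%N / 1); exact: Eub].
exists (sup E) => -[|n].
  by rewrite mul0r add0r; have := usub 0%N 0%N; have := usup 0%N 0%N; rewrite addn0; lra.
have n0 : 0 < (n.+1)%:R :> R by rewrite ltr0n.
have h1 : sup E <= u n.+1 / (n.+1)%:R by apply: ge_sup; [by case: supE|exact: Eub].
have h2 : (u n.+1 - C) / (n.+1)%:R <= sup E by apply: ub_le_sup; [by case: supE|exists n].
move: h1 h2; rewrite ler_pdivlMr// ler_pdivrMr// ![sup E * _]mulrC; lra.
Qed.

Lemma natr_mul_le_cst (x y C : R) :
  (forall n, n%:R * x <= n%:R * y + C) -> x <= y.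
Proof.
move=> H; rewrite leNgt; apply/negP => yx.
have := H (Num.truncn (C / (x - y))).+1.
have := truncnS_gt (C / (x - y)).
rewrite ltr_pdivrMr ?subr_gt0//; move: (_%:R) => N; lra.
Qed.

End quasi_linear.

(** Meaningful where the sum is finite, in particular for [s > 1/2]; [fine] turns an infinite sum
    into 0. *)
HB.lock Definition cf_partition (R : realType) (s : R) (n : nat) : R :=
  fine (word_sum R s (words n)).

Section partition_function.
Variable R : realType.
Implicit Types (s t c x y : R).

Lemma words_cat n m : words (n + m) = cat_set (words n) (words m).
Proof.
apply/seteqP; split => [w [pw sw]|_ [u [pu su] [v [pv sv] <-]]].
  move: (pw); rewrite -{1}(cat_take_drop n w) all_cat => /andP[p1 p2].
  exists (take n w); last first.
    by exists (drop n w); [split=> //; rewrite size_drop sw addKn|exact: cat_take_drop].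
  by split=> //; rewrite size_takel// sw leq_addr.
by split; [rewrite all_cat pu|rewrite size_cat su sv].
Qed.

Lemma words0 : words 0 = [set [::]].
Proof. by apply/seteqP; split=> [w [_ /size0nil ->//]|_ ->]. Qed.

Lemma words1 : words 1 = [set [:: i.+1] | i in [set: nat]].
Proof.
apply/seteqP; split => [[|[|a] [|b w]] [//= pw sw]|_ [i _ <-]//].
by exists a.
Qed.

Lemma weight1 s i : weight R s [:: i.+1] = (i.+1)%:R `^ (- (1 + (2 * s - 1))).
Proof. by rewrite /weight /cf_denominator /= muln1 addn0; congr (_ `^ _); ring. Qed.

Lemma word_sum1E s :
  word_sum R s (words 1) = (\sum_(i <oo) (weight R s [:: i.+1])%:E)%E.
Proof.
rewrite nneseries_esumT; last by move=> n; exact: weight_fin_ge0.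
by rewrite words1 /word_sum esum_image// => i j _ _ [].
Qed.

Lemma word_sum1_le s : 1 / 2 < s ->
  (word_sum R s (words 1) <= (1 + (2 * s - 1)^-1)%:E)%E.
Proof.
move=> s2; rewrite word_sum1E; apply: lime_le.
  by apply: is_cvg_nneseries => n _ _; exact: weight_fin_ge0.
apply: nearW => n; rewrite big_mkord sumEFin lee_fin.
under eq_bigr do rewrite weight1.
by apply: sum_powR_le; lra.
Qed.

Lemma word_sum1_ge s M : 1 / 2 < s ->
  (((2 * s - 1)^-1 * (1 - (M.+1)%:R `^ (- (2 * s - 1))))%:E <=
    word_sum R s (words 1))%E.
Proof.
move=> s2; rewrite word_sum1E.
apply: le_trans (@nneseries_lim_ge _ _ _ 0%N M _); last first.
  by move=> n _ _; exact: weight_fin_ge0.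
rewrite big_mkord sumEFin lee_fin.
under eq_bigr do rewrite weight1.
by apply: sum_powR_ge; lra.
Qed.

Lemma word_sum_words_bound s n : 1 / 2 < s ->
  exists a : R, (word_sum R s (words n) <= a%:E)%E.
Proof.
move=> s2; elim: n => [|n [a IH]].
  by exists 1; rewrite words0 /word_sum esum_set1 ?weight_fin_ge0// weight_nil.
exists ((1 + (2 * s - 1)^-1) * a); rewrite -add1n words_cat.
apply: word_sum_cat IH => //; [by lra|by move=> w []|by move=> w []|].
exact: word_sum1_le.
Qed.

Lemma cf_partitionE s n : 1 / 2 < s -> word_sum R s (words n) = (cf_partition R s n)%:E.
Proof.
move=> s2; rewrite cf_partition.unlock fineK// ge0_fin_numE ?word_sum_ge0//.
by have [a /le_lt_trans] := word_sum_words_bound _ n s2; apply; rewrite ltry.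
Qed.

Lemma cf_partition_gt0 s n : 1 / 2 < s -> 0 < cf_partition R s n.
Proof.
move=> s2; rewrite -lte_fin -cf_partitionE//.
have pw : words n (nseq n 1%N).
  by split; rewrite ?size_nseq//; elim: n.
apply: (@lt_le_trans _ _ (word_sum R s [set (nseq n 1%N)])).
  by rewrite /word_sum esum_set1 ?weight_fin_ge0// lte_fin weight_gt0//; case: pw.
by apply: word_sum_subset => _ ->.
Qed.

Lemma cf_partitionD_le s n m : 1 / 2 < s ->
  cf_partition R s (n + m) <= cf_partition R s n * cf_partition R s m.
Proof.
move=> s2; rewrite -lee_fin -cf_partitionE// words_cat.
by apply: word_sum_cat; rewrite ?cf_partitionE//; [lra|move=> w []|move=> w []].
Qed.

Lemma cf_partitionD_ge s n m : 1 / 2 < s ->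
  cf_partition R s n * cf_partition R s m <= 4 `^ s * cf_partition R s (n + m).
Proof.
move=> s2; rewrite -lee_fin !EFinM -!cf_partitionE// words_cat.
apply: (@word_sum_cat_ge _ _ _ _ n) => //; first by lra.
- by move=> w [].
- by rewrite cf_partitionE// lte_fin cf_partition_gt0.
- by rewrite cf_partitionE// ltry.
Qed.

Lemma cf_partition_slope s : 1 / 2 < s -> exists l, forall n,
  n%:R * l <= ln (cf_partition R s n) <= n%:R * l + ln (4 `^ s).
Proof.
move=> s2; apply: quasi_linear_slope => n m; rewrite -!lnM ?posrE ?cf_partition_gt0 ?powR_gt0//.
  by rewrite ler_ln ?posrE ?mulr_gt0 ?cf_partition_gt0// cf_partitionD_le.
by rewrite ler_ln ?posrE ?mulr_gt0 ?powR_gt0 ?cf_partition_gt0// cf_partitionD_ge.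
Qed.

Lemma esum_tuple_cf_partition s n : 1 / 2 < s ->
  (\esum_(a in [set a : n.-tuple nat | forall i, (0 < tnth a i)%N])
     ((cf_denominator a)%:R `^ (- (2 * s)))%:E)%E = (cf_partition R s n)%:E.
Proof.
move=> s2; rewrite -cf_partitionE// /word_sum.
rewrite (@reindex_esum _ _ _ [set a : n.-tuple nat | forall i, (0 < tnth a i)%N]
  (words n) (fun a : n.-tuple nat => a : seq nat))//.
split.
- by move=> a /= a0; split; [apply/all_tnthP|rewrite size_tuple].
- by move=> a b _ _; exact: val_inj.
- move=> w [pw /eqP sw]; exists (Tuple sw) => //= i.
  by move/all_tnthP : (pw : all (leq 1) (Tuple sw)); exact.
Qed.

(** Later estimates rely on the two-sided bound and not only on the limit: the sum over words of
    length [n] is [e^(n P)] up to a factor [4^s], for every [n]. *)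
Lemma pressureP s : 1 / 2 < s -> exists2 l, pressure s = l%:E & forall n,
  n%:R * l <= ln (cf_partition R s n) <= n%:R * l + ln (4 `^ s).
Proof.
move=> s2; have [l lP] := cf_partition_slope s s2; exists l => //.
rewrite /pressure; apply: cvg_lim => //.
apply: (@cvg_trans _ ((n%:R^-1 * ln (cf_partition R s n))%:E @[n --> \oo])).
  apply: near_eq_cvg; apply: nearW => n /=.
  by rewrite esum_tuple_cf_partition// lne_EFin ?cf_partition_gt0// EFinM.
apply: cvg_EFin; first exact: nearW.
set C := ln (4 `^ s) in lP.
have C0 : 0 <= C by have := lP 0%N; lra.
apply/cvgrPdist_le => e e0; near=> n.
have n0 : 0 < n%:R :> R by near: n; exact: nbhs_infty_gtr.
have Cn : C <= e * n%:R.
  by rewrite mulrC -ler_pdivrMr// ltW//; near: n; exact: nbhs_infty_gtr.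
have /andP[h1 h2] := lP n.
rewrite /= distrC ler_norml; apply/andP; split.
  rewrite lerBrDr mulrC ler_pdivlMr//; nra.
rewrite lerBlDr mulrC ler_pdivrMr//; nra.
Unshelve. all: by end_near. Qed.

End partition_function.

(** * Monotonicity and convexity of the pressure *)

HB.lock Definition rpressure (R : realType) (s : R) : R := fine (pressure s).
Arguments rpressure {R}.

Section pressure_function.
Variable R : realType.
Implicit Types (s t c a b l x y : R).

Lemma pressureE s : 1 / 2 < s -> pressure s = (rpressure s)%:E.
Proof. by move=> /(pressureP R)[l lE _]; rewrite rpressure.unlock lE. Qed.

Lemma rpressure_slope s n : 1 / 2 < s ->
  n%:R * rpressure s <= ln (cf_partition R s n) <= n%:R * rpressure s + ln (4 `^ s).
Proof. by move=> /(pressureP R)[l lE lP]; rewrite rpressure.unlock lE /=. Qed.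

Lemma rpressure_antitone s t : 1 / 2 < s -> s <= t -> rpressure t <= rpressure s.
Proof.
move=> s2 st; have t2 := lt_le_trans s2 st.
apply: (natr_mul_le_cst _ _ _ (ln (4 `^ s))) => n.
have /andP[h1 _] := rpressure_slope _ n t2.
have /andP[_ h2] := rpressure_slope _ n s2.
apply: (le_trans h1); apply: le_trans h2.
rewrite ler_ln ?posrE ?cf_partition_gt0// -lee_fin -!cf_partitionE//.
apply: le_esum => w [pw _]; rewrite lee_fin.
by apply: ler_powR; [rewrite ler1n cf_denominator_gt0|lra].
Qed.

(** Both values lie above the tangent at the weighted mean [m], and the linear terms cancel. *)
Lemma expR_convex_combination l x y : 0 <= l <= 1 ->
  expR (l * x + (1 - l) * y) <= l * expR x + (1 - l) * expR y.
Proof.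
move=> /andP[l0 l1]; set m := _ + _.
have H z : expR m * (1 + (z - m)) <= expR z.
  have -> : expR z = expR m * expR (z - m) by rewrite -expRD addrC subrK.
  by rewrite ler_wpM2l ?expR_ge0// expR_ge1Dx.
have hx : l * (expR m * (1 + (x - m))) <= l * expR x by rewrite ler_wpM2l.
have hy : (1 - l) * (expR m * (1 + (y - m))) <= (1 - l) * expR y.
  by rewrite ler_wpM2l// subr_ge0.
apply: le_trans (lerD hx hy).
suff -> : l * (expR m * (1 + (x - m))) + (1 - l) * (expR m * (1 + (y - m))) = expR m.
  by [].
by rewrite /m; ring.
Qed.

Lemma weightE s w : all (leq 1) w ->
  weight R s w = expR (- (2 * s) * ln (cf_denominator w)%:R).
Proof.
by move=> pw; rewrite /weight /powR gt_eqF// ltr0n cf_denominator_gt0.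
Qed.

(** Hoelder's inequality: each term is normalised by the sums [A] and [B], convexity of the
    exponential is applied to it, and the results are summed. *)
Lemma cf_partition_log_convex l a b n : 0 < l < 1 -> 1 / 2 < a -> 1 / 2 < b ->
  ln (cf_partition R (l * a + (1 - l) * b) n) <=
  l * ln (cf_partition R a n) + (1 - l) * ln (cf_partition R b n).
Proof.
move=> /andP[l0 l1] a2 b2.
have s2 : 1 / 2 < l * a + (1 - l) * b by nra.
have l01c : 0 <= l <= 1 by rewrite !ltW.
set A := cf_partition R a n; set B := cf_partition R b n.
have A0 : 0 < A by exact: cf_partition_gt0.
have B0 : 0 < B by exact: cf_partition_gt0.
set K := expR (l * ln A + (1 - l) * ln B).
have K0 : 0 < K by exact: expR_gt0.
rewrite -[leRHS]expRK ler_ln ?posrE ?cf_partition_gt0// -/K.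
rewrite -lee_fin -cf_partitionE//.
have ca : 0 < K * l / A by rewrite divr_gt0 ?mulr_gt0.
have cb : 0 < K * (1 - l) / B by rewrite divr_gt0 ?mulr_gt0// subr_gt0.
apply: (@le_trans _ _ (\esum_(w in words n)
   ((K * l / A)%:E * (weight R a w)%:E + (K * (1 - l) / B)%:E * (weight R b w)%:E))%E).
  apply: le_esum => w [pw _]; rewrite -!EFinM -EFinD lee_fin !weightE//.
  set q := ln _.
  have := @expR_convex_combination l (- (2 * a) * q - ln A) (- (2 * b) * q - ln B).
  move=> /(_ l01c); rewrite [in leRHS]expRB [in leRHS]expRB !lnK ?posrE//.
  move=> /(ler_wpM2l (ltW K0)); rewrite {1}/K -expRD => h.
  have -> : - (2 * (l * a + (1 - l) * b)) * q =
      l * ln A + (1 - l) * ln B +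
      (l * (- (2 * a) * q - ln A) + (1 - l) * (- (2 * b) * q - ln B)) by ring.
  by apply: (le_trans h); rewrite le_eqVlt; apply/orP; left; apply/eqP; ring.
rewrite esumD; last 2 first.
- by move=> w _; rewrite mule_ge0 ?weight_fin_ge0// lee_fin ltW.
- by move=> w _; rewrite mule_ge0 ?weight_fin_ge0// lee_fin ltW.
rewrite !esum_mull//; try by move=> w; exact: weight_fin_ge0.
rewrite -!/(word_sum _ _ _) !cf_partitionE// -!EFinM -EFinD lee_fin -/A -/B.
by rewrite !divfK ?gt_eqF//; lra.
Qed.

Lemma rpressure_convex l a b : 0 < l < 1 -> 1 / 2 < a -> 1 / 2 < b ->
  rpressure (l * a + (1 - l) * b) <= l * rpressure a + (1 - l) * rpressure b.
Proof.
move=> l01 a2 b2; have /andP[l0 l1] := l01.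
have s2 : 1 / 2 < l * a + (1 - l) * b by nra.
apply: (natr_mul_le_cst _ _ _ (l * ln (4 `^ a) + (1 - l) * ln (4 `^ b))) => n.
have /andP[h1 _] := rpressure_slope _ n s2.
have /andP[_ h2] := rpressure_slope _ n a2.
have /andP[_ h3] := rpressure_slope _ n b2.
apply: (le_trans h1); apply: (le_trans (cf_partition_log_convex _ _ _ n l01 a2 b2)).
nra.
Qed.

Lemma rpressure_gt_line c : 0 < c -> exists2 a, 1 / 2 < a & c * (a - 1 / 2) < rpressure a.
Proof.
move=> c0.
(* With [2 a - 1 = r], the sum over one digit is at least [1 / (2 r) = 8 e^(c/2)]. Subtracting the
   error [ln (4^a) <= ln 4] leaves a pressure above [c / 2], hence above [c r / 2 = c (a - 1/2)]. *)
pose r := expR (- (c / 2)) / 16.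
have r0 : 0 < r by rewrite divr_gt0 ?expR_gt0.
have r1 : r < 1.
  by rewrite /r ltr_pdivrMr// mul1r (@lt_trans _ _ 1)// ?ltr1n// expR_lt1; lra.
pose a := (1 + r) / 2.
have a2 : 1 / 2 < a by rewrite /a; lra.
exists a => //.
have /andP[_] := rpressure_slope _ 1 a2; rewrite mul1r => h.
pose M := (Num.truncn (2 `^ r^-1 : R)).
have hM : (M.+1)%:R `^ (- r) <= 1 / 2 :> R.
  rewrite powRN -[1 / 2]invrK lef_pV2 ?posrE ?powR_gt0 ?ltr0n//.
  have -> : (1 / 2)^-1 = (2 `^ r^-1) `^ r :> R.
    by rewrite -powRrM mulVf ?gt_eqF// powRr1// div1r invrK.
  apply: ge0_ler_powR; rewrite ?nnegrE ?powR_ge0//; first exact: ltW.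
  by rewrite ltW// truncnS_gt.
have := word_sum1_ge R a M a2.
have -> : 2 * a - 1 = r by rewrite /a; field.
rewrite cf_partitionE// lee_fin => hz.
have z8 : 8 * expR (c / 2) <= cf_partition R a 1.
  apply: le_trans hz.
  have -> : r^-1 = 16 * expR (c / 2).
    by rewrite /r invf_div expRN invrK.
  have := expR_gt0 (c / 2); nra.
have l8 : ln 8 + c / 2 <= ln (cf_partition R a 1).
  rewrite -[X in _ + X]expRK -lnM ?posrE ?expR_gt0// ler_ln ?posrE ?cf_partition_gt0//.
  by rewrite mulr_gt0 ?expR_gt0.
have l4 : ln (4 `^ a) <= ln 4.
  by rewrite ln_powR ler_piMl ?ln_ge0 ?ler1n// /a; lra.
have l48 : ln 4 < ln 8 :> R by rewrite ltr_ln ?posrE// ltr_nat.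
have : c * (a - 1 / 2) <= c / 2 by rewrite /a; nra.
lra.
Qed.

Lemma rpressure_lt_line c : 0 < c -> exists2 b, 1 / 2 < b & rpressure b < c * (b - 1 / 2).
Proof.
(* With [2 b - 1 = r] the line has height [c r / 2 = 1 + c / 2], whereas the pressure is at most
   [ln (1 + 1/r) <= 1/r < 1]. *)
move=> c0; pose r := 1 + 2 / c.
have c2 : 0 < 2 / c by rewrite divr_gt0.
pose b := (1 + r) / 2.
have b2 : 1 / 2 < b by rewrite /b /r; lra.
exists b => //.
have /andP[h _] := rpressure_slope _ 1 b2; rewrite mul1r in h.
apply: (le_lt_trans h).
have := word_sum1_le R b b2.
have -> : 2 * b - 1 = r by rewrite /b; field.
rewrite cf_partitionE// lee_fin => hz.
have rV : r^-1 < 1 by rewrite invf_lt1 /r; lra.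
have rV0 : 0 < r^-1 by rewrite invr_gt0 /r; lra.
have : ln (cf_partition R b 1) <= ln (1 + r^-1).
  by rewrite ler_ln ?posrE ?cf_partition_gt0// addr_gt0.
have : ln (1 + r^-1) <= r^-1 by apply: le_ln1Dx; lra.
have -> : c * (b - 1 / 2) = 1 + c / 2.
  by rewrite /b /r; field; rewrite gt_eqF.
lra.
Qed.

(** The root is the supremum [T] of the points where the pressure is not below the line. The
    difference [g] is convex and strictly decreasing, and chords of [g] exclude a jump across 0 at
    [T] in either direction. *)
Lemma rpressure_root c : 0 < c ->
  exists2 theta, 1 / 2 < theta & rpressure theta = c * (theta - 1 / 2).
Proof.
move=> c0.
have [a a2 ga] := rpressure_gt_line c c0.
have [b b2 gb] := rpressure_lt_line c c0.
pose E := [set s | 1 / 2 < s /\ c * (s - 1 / 2) <= rpressure s].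
have Eb : ubound E b.
  move=> s [s2 hs]; rewrite leNgt; apply/negP => bs.
  have := rpressure_antitone _ _ b2 (ltW bs); nra.
have Ea : E a by split => //; exact: ltW.
have supE : has_sup E by split; [exists a|exists b].
have aT : a <= sup E by apply: ub_le_sup; [case: supE|].
have Tb : sup E <= b by apply: ge_sup; [exists a|].
set T := sup E in aT Tb *.
have T2 : 1 / 2 < T by exact: lt_le_trans a2 aT.
pose g s := rpressure s - c * (s - 1 / 2).
have gconv l x y : 0 < l < 1 -> 1 / 2 < x -> 1 / 2 < y ->
    g (l * x + (1 - l) * y) <= l * g x + (1 - l) * g y.
  move=> l01 x2 y2; rewrite /g.
  have -> : l * (rpressure x - c * (x - 1 / 2)) + (1 - l) * (rpressure y - c * (y - 1 / 2))
      = l * rpressure x + (1 - l) * rpressure y - c * (l * x + (1 - l) * y - 1 / 2) by ring.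
  by rewrite lerD2r; exact: rpressure_convex.
have ganti x y : 1 / 2 < x -> x < y -> g y < g x.
  move=> x2 xy; have h := rpressure_antitone _ _ x2 (ltW xy).
  by apply: (ler_ltB h); rewrite ltr_pM2l// ltrD2r.
have ga0 : 0 < g a by rewrite /g; lra.
exists T => //; apply/eqP; rewrite eq_le; apply/andP; split; rewrite leNgt; apply/negP => gT.
- have gT0 : 0 < g T by rewrite /g; lra.
  have aT' : a - 1 < T by lra.
  pose A := (a + 1 / 2) / 2.
  have A2 : 1 / 2 < A by rewrite /A; lra.
  have AT : A < T by apply: lt_le_trans aT; rewrite /A; lra.
  have gA : g T < g A by apply: ganti.
  have gA0 : 0 < g A by lra.
  (* [T] is written as a convex combination of [A] and a point [s > T], with [A] contributing only
     [g T / 2]. As [g s < 0], convexity would give [g T < g T / 2]. *)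
  pose l := g T / (2 * g A).
  have l0 : 0 < l by rewrite divr_gt0// mulr_gt0.
  have lE : l * g A = g T / 2 by rewrite /l; field; rewrite gt_eqF.
  have l1 : l < 1 by rewrite /l ltr_pdivrMr ?mulr_gt0//; lra.
  pose s := (T - l * A) / (1 - l).
  have Ts : T < s by rewrite /s ltr_pdivlMr; nra.
  have TE : T = l * A + (1 - l) * s.
    by rewrite /s [(1 - l) * _]mulrC divfK ?gt_eqF//; lra.
  have s2 : 1 / 2 < s by lra.
  have := gconv l A s; rewrite -TE l0 l1 => /(_ isT A2 s2).
  have gs0 : g s < 0.
    rewrite ltNge; apply/negP => gs0.
    have : s <= T by apply: ub_le_sup; [case: supE|split => //; rewrite /g in gs0; lra].
    lra.
  have : 0 < 1 - l by lra.
  nra.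
- have gT0 : g T < 0 by rewrite /g; lra.
  have aT' : a < T.
    by rewrite lt_neqAle aT andbT; apply/eqP => aTe; move: gT0; rewrite -aTe; lra.
  (* On the chord from [T] to [a], this [l] marks the point of height [g T / 2 < 0]. So [g] is
     negative at some [s < T], against the choice of [T]. *)
  pose l := - g T / (2 * (g a - g T)).
  have d0 : 0 < 2 * (g a - g T) by lra.
  have l0 : 0 < l by rewrite divr_gt0// oppr_gt0.
  have l1 : l < 1 by rewrite /l ltr_pdivrMr//; lra.
  have lE : l * (g a - g T) = - g T / 2 by rewrite /l; field; rewrite gt_eqF//; lra.
  pose s := l * a + (1 - l) * T.
  have sT : s < T by rewrite /s; nra.
  have s2 : 1 / 2 < s by rewrite /s; nra.
  have [t Et st] := sup_gt supE.1 sT.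
  have [t2 ht] := Et.
  have := gconv l a T; rewrite l0 l1 -/s => /(_ isT a2 T2).
  have : g t < g s by apply: ganti.
  have : 0 <= g t by rewrite /g; lra.
  lra.
Qed.

End pressure_function.

(** * Mass distribution on a tree *)

Section mass_distribution.
Variables (R : realType) (T : choiceType) (B : nat -> seq T) (p : nat -> T -> R).
Variables (X : (nat -> T) -> R) (s C : R).
Implicit Types (b g : nat -> T) (v w : seq T) (U : set R).

Definition is_branch b := forall k, b k \in B k.

(** With [p k x] as conditional probabilities, the probability that a random branch follows [v] from
    level [k] on. *)
Fixpoint node_mass (k : nat) v : R :=
  if v is x :: v' then p k x * node_mass k.+1 v' else 1.

Lemma node_mass_rcons k v x :
  node_mass k (rcons v x) = node_mass k v * p (k + size v)%N x.
Proof.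
elim: v k => [|y v IH] k /=; first by rewrite addn0 mulrC.
by rewrite IH addSnnS mulrA.
Qed.

Hypothesis B_uniq : forall k, uniq (B k).
Hypothesis p_ge0 : forall k x, 0 <= p k x.
Hypothesis p_sum : forall k, \sum_(x <- B k) p k x = 1.
Hypothesis s_ge0 : 0 <= s.
Hypothesis C_gt0 : 0 < C.
Hypothesis separation : forall b g k, is_branch b -> is_branch g ->
  (forall j, (j < k)%N -> b j = g j) -> b k <> g k ->
  node_mass 0 (mkseq b k) <= C * `|X b - X g| `^ s.
Hypothesis mass_vanish : forall b, is_branch b -> forall e : R, 0 < e ->
  exists k, node_mass 0 (mkseq b k) <= e.

Lemma node_mass_ge0 k v : 0 <= node_mass k v.
Proof. by elim: v k => //= x v IH k; rewrite mulr_ge0. Qed.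

Lemma first_difference b g : b <> g ->
  exists2 k, (forall j, (j < k)%N -> b j = g j) & b k <> g k.
Proof.
move=> bg; have exk : exists k, b k != g k.
  apply: contrapT => H; apply: bg; apply/funext => k; apply/eqP.
  by apply: contrapT => /negP bgk; apply: H; exists k.
exists (ex_minn exk); case: ex_minnP => m bgm mP; last exact/eqP.
move=> j jm; apply/eqP; apply: contraTT jm => /mP; by rewrite -leqNgt.
Qed.

Lemma dist_le_diameter_pow U x y : U x -> U y ->
  ((`|x - y| `^ s)%:E <= diameter_pow s U)%E.
Proof.
move=> Ux Uy; rewrite /diameter_pow; case: eqP => [U0|_].
  by move: Ux; rewrite U0.
have xyU : (`|x - y|%:E <= diameter U)%E.
  by apply: ereal_sup_ubound; exists x => //; exists y.
rewrite -poweR_EFin; apply: gt0_ler_poweR => //.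
- by rewrite in_itv /= lee_fin normr_ge0 leey.
- by rewrite in_itv /= leey andbT; apply: le_trans xyU; rewrite lee_fin.
Qed.

Lemma diameter_pow_ge0 U : (0 <= diameter_pow s U)%E.
Proof. by rewrite /diameter_pow; case: eqP => // _; exact: poweR_ge0. Qed.

(* The node is the last common ancestor of the branches that land in U; if
   there is only one such branch, it is a node of small mass on it. *)
Lemma covering_node U (e : R) : 0 < e -> exists2 w : option (seq T),
  ((oapp (node_mass 0) 0 w)%:E <= C%:E * diameter_pow s U + e%:E)%E
  & forall b, is_branch b -> U (X b) -> exists k, w = Some (mkseq b k).
Proof.
move=> e0; have CU0 : (0 <= C%:E * diameter_pow s U)%E.
  by rewrite mule_ge0 ?diameter_pow_ge0// lee_fin ltW.
have [[b bB Ub]|noU] := pselect (exists2 b, is_branch b & U (X b)); last first.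
  exists None => [|b bB Ub]; last by exfalso; apply: noU; exists b.
  by rewrite adde_ge0// lee_fin ltW.
pose split_at k := exists b g, [/\ is_branch b /\ U (X b), is_branch g /\ U (X g),
  (forall j, (j < k)%N -> b j = g j) & b k <> g k].
have [exk|nok] := pselect (exists k, split_at k); last first.
  have [k bk] := mass_vanish b bB e e0.
  exists (Some (mkseq b k)) => [/=|g gB Ug].
    by apply: (@le_trans _ _ e%:E); rewrite ?lee_fin// leeDr.
  have [->|/first_difference[j bgj bgj']] := pselect (b = g); first by exists k.
  by exfalso; apply: nok; exists j; exists b, g.
have exkb : exists k, `[< split_at k >] by case: exk => k ?; exists k; apply/asboolP.
have [k /asboolP[b1 [g1 [[b1B Ub1] [g1B Ug1] bg1 nbg1]]] kmin] := ex_minnP exkb.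
exists (Some (mkseq b1 k)) => [/=|g gB Ug].
  apply: (@le_trans _ _ (C%:E * diameter_pow s U)%E); last by rewrite leeDl// lee_fin ltW.
  apply: (@le_trans _ _ (C * `|X b1 - X g1| `^ s)%:E).
    by rewrite lee_fin separation.
  by rewrite EFinM lee_wpmul2l ?lee_fin ?(ltW C_gt0)// dist_le_diameter_pow.
exists k; congr Some; apply/eq_in_map => j; rewrite mem_iota => /andP[_ jk].
have [->//|/first_difference[i bgi bgi']] := pselect (b1 = g).
have ki : (k <= i)%N by apply: kmin; apply/asboolP; exists b1, g.
by apply: bgi; exact: leq_trans jk ki.
Qed.

(* A node is light if the marked nodes w_i below it weigh less than it does. A
   light node has a light child, and a marked node is never light: hence a
   branch of light nodes avoids all the w_i. *)
Section avoid.
Variable w : nat -> option (seq T).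

Definition load_term v i : R :=
  if oapp (prefix v) false (w i) then oapp (node_mass 0) 0 (w i) else 0.

Definition load v : \bar R := (\sum_(0 <= i <oo) (load_term v i)%:E)%E.

Lemma load_term_ge0 v i : 0 <= load_term v i.
Proof.
rewrite /load_term; case: ifP => // _.
by case: (w i) => //= a; exact: node_mass_ge0.
Qed.

(** A marked node lies below at most one child of [v], and below none if it is [v] itself. *)
Lemma sum_load_term_le v k i :
  \sum_(x <- B k) load_term (rcons v x) i <= load_term v i.
Proof.
rewrite /load_term; case: (w i) => [u|] /=; last by rewrite big1.
have [[x xB /prefixP[u' uE]]|nox] :=
  pselect (exists2 x, x \in B k & prefix (rcons v x) u); last first.
  rewrite big_seq big1 => [|x xB]; first by case: ifP => // _; exact: node_mass_ge0.
  by rewrite ifF//; apply/negP => xu; apply: nox; exists x.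
have vu : prefix v u by rewrite uE cat_rcons prefix_prefix.
rewrite vu (bigD1_seq x)//= ifT; last by rewrite uE prefix_prefix.
rewrite big1 ?addr0// => y yx; rewrite ifF//; apply/negP => /prefixP[u2].
rewrite uE !cat_rcons => /eqP; rewrite eqseq_cat// eqxx /= eqseq_cons => /andP[/eqP xy _].
by rewrite xy eqxx in yx.
Qed.

(** The masses of the children add up to that of [v], and their loads to at most that of [v]; so
    they cannot all be heavy. *)
Lemma exists_light_child v :
  (load v < (node_mass 0 v)%:E)%E ->
  exists2 x, x \in B (size v) & (load (rcons v x) < (node_mass 0 (rcons v x))%:E)%E.
Proof.
move=> lv; apply: contrapT => nox.
suff : ((node_mass 0 v)%:E <= load v)%E by rewrite leNgt lv.
rewrite -[node_mass 0 v]mulr1 -(p_sum (size v)) mulr_sumr.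
apply: (@le_trans _ _ (\sum_(x <- B (size v)) load (rcons v x))%E).
  rewrite -sumEFin big_seq [leRHS]big_seq; apply: lee_sum => x xB.
  rewrite leNgt; apply/negP => H; apply: nox; exists x => //.
  by rewrite node_mass_rcons add0n.
rewrite /load -nneseries_sum; last by move=> x i _; rewrite lee_fin load_term_ge0.
apply: lee_nneseries => [i _ _|i _]; rewrite sumEFin lee_fin.
  by apply: sumr_ge0 => x _; exact: load_term_ge0.
exact: sum_load_term_le.
Qed.

Lemma exists_light_branch : (load [::] < 1%:E)%E ->
  exists2 b, is_branch b & forall k, (load (mkseq b k) < (node_mass 0 (mkseq b k))%:E)%E.
Proof.
move=> l0; have [x0 _ _] := exists_light_child [::] l0.
pose light v := (load v < (node_mass 0 v)%:E)%E.
have /choice[nxt nxtP] : forall v, exists x, light v ->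
    x \in B (size v) /\ light (rcons v x).
  move=> v; have [lv|nlv] := pselect (light v); last by exists x0.
  by have [x xB lx] := exists_light_child v lv; exists x.
pose V n := iter n (fun v => rcons v (nxt v)) [::].
have VP n : V n = mkseq (nxt \o V) n /\ light (V n).
  elim: n => [//|n [VE lV]]; rewrite /V iterS -/(V n); split.
    by rewrite mkseqS -VE.
  by have [] := nxtP _ lV.
exists (nxt \o V) => [k|k].
  have [VE lV] := VP k; have [] := nxtP _ lV.
  by rewrite {2}VE size_mkseq.
by have [<-] := VP k.
Qed.

End avoid.

(** If the cost were below [1 / C], the covering nodes would have total mass less than 1 and the
    root would be light. The point of a branch of light nodes lies in some [U i], so the branch
    passes through the marked node of [U i], which is not light. *)
Theorem mass_distribution (U : nat -> set R) :
  (forall b, is_branch b -> exists i, U i (X b)) ->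
  ((C^-1)%:E <= \sum_(0 <= i <oo) diameter_pow s (U i))%E.
Proof.
move=> cover; rewrite leNgt; apply/negP => small.
set S := (\sum_(0 <= i <oo) _)%E in small.
have S0 : (0 <= S)%E by apply: nneseries_ge0 => i _ _; exact: diameter_pow_ge0.
have Sfin : S \is a fin_num by rewrite ge0_fin_numE// (lt_trans small)// ltry.
have SE := fineK Sfin; move: small; rewrite -SE lte_fin => small.
set r := fine S in small SE.
have Cr : C * r < 1 by rewrite -ltr_pdivlMl// mulr1.
(* Half of the slack, spread over the [U i] as [e / 2^(i+1)], pays for the sets that meet a single
   branch. *)
pose e := (1 - C * r) / 2.
have e0 : 0 < e by rewrite /e; lra.
have /choice[w wP] : forall i, exists w : option (seq T),
  ((oapp (node_mass 0) 0 w)%:E <= C%:E * diameter_pow s (U i) + (e / (2 ^ i.+1)%:R)%:E)%E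
  /\ forall b, is_branch b -> U i (X b) -> exists k, w = Some (mkseq b k).
  move=> i; have ei : 0 < e / (2 ^ i.+1)%:R by rewrite divr_gt0// ltr0n expn_gt0.
  by have [w w1 w2] := covering_node (U i) _ ei; exists w.
have root_light : (load w [::] < 1%:E)%E.
  apply: (@le_lt_trans _ _ (C%:E * S + e%:E)%E).
    rewrite /S -nneseriesZl; last by move=> i _; exact: diameter_pow_ge0.
    apply: le_trans (epsilon_trick _ _ _); last 2 first.
    - by move=> i; rewrite mule_ge0 ?diameter_pow_ge0// lee_fin ltW.
    - exact: ltW.
    apply: lee_nneseries => [i _ _|i _]; first by rewrite lee_fin load_term_ge0.
    have [wi _] := wP i; apply: le_trans wi; rewrite lee_fin /load_term.
    by case: (w i) => [v|] /=; rewrite ?prefix0s.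
  by rewrite -SE -EFinM -EFinD lte_fin /e; lra.
have [b bB bP] := exists_light_branch w root_light.
have [i Ui] := cover b bB.
have [_ /(_ b bB Ui)[k wi]] := wP i.
have := bP k; rewrite ltNge => /negP; apply.
apply: (@le_trans _ _ (\sum_(0 <= j < i.+1) (load_term w (mkseq b k) j)%:E)%E).
  rewrite big_nat_recr//= {2}/load_term wi /= prefix_refl leeDr//.
  by apply: sume_ge0 => j _; rewrite lee_fin load_term_ge0.
by apply: nneseries_lim_ge => j _ _; rewrite lee_fin load_term_ge0.
Qed.

End mass_distribution.

(** * Upper bound for the dimension *)

Section psi_values.
Variables (R : realType) (c : R) (psi : nat -> R).
Hypothesis c_gt0 : 0 < c.
Hypothesis ln_psi : forall n : nat, (1 <= n)%N ->
  ln (psi n) = c * (Num.floor (Num.sqrt (n%:R : R)))%:~R.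

Lemma floor_sqrt_natr (k n : nat) : (k ^ 2 <= n < k.+1 ^ 2)%N ->
  Num.floor (Num.sqrt (n%:R : R)) = k%:Z.
Proof.
move=> /andP[kn nk]; apply: floor_def; apply/andP; split.
  have -> : (k%:Z)%:~R = Num.sqrt ((k ^ 2)%N%:R) :> R.
    by rewrite natrX sqrtr_sqr ger0_norm.
  by rewrite ler_wsqrtr// ler_nat.
have -> : (k%:Z + 1)%:~R = Num.sqrt ((k.+1 ^ 2)%N%:R) :> R.
  by rewrite natrX sqrtr_sqr ger0_norm// intrD natr1.
by rewrite ltr_sqrt ?ltr_nat// ltr0n; lia.
Qed.

Lemma psiE (k n : nat) : (1 <= n)%N -> (k ^ 2 <= n < k.+1 ^ 2)%N ->
  psi n = expR (c * k%:R).
Proof.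
move=> n1 kn; have := ln_psi n n1; rewrite (floor_sqrt_natr k)// => lnpsi.
have k0 : 0 < k%:R :> R by rewrite ltr0n; case: k kn {lnpsi} => //; lia.
(* [ln] is 0 on nonpositive arguments, so the positive value [c k] forces [psi n > 0]. *)
rewrite -[LHS]lnK ?lnpsi// posrE ltNge; apply/negP => psi0.
by have := ln0 psi0; rewrite lnpsi => /eqP; rewrite gt_eqF// mulr_gt0.
Qed.

End psi_values.

Section cylinders.
Variable R : realType.
Implicit Types (w : seq nat) (x y s : R).

Definition cylinder w : set R :=
  [set x | exists2 a, cf_expansion x a & mkseq a (size w) = w].

Lemma cylinder_dist w x y : all (leq 1) w -> cylinder w x -> cylinder w y ->
  `|x - y| <= (cf_denominator w)%:R ^- 2.
Proof.
move=> pw [a xa aw] [b yb bw].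
have [x' x'a ->] := cf_expansion_tail _ _ _ (size w) xa.
have [y' y'b ->] := cf_expansion_tail _ _ _ (size w) yb.
rewrite aw bw; apply: cf_tail_dist_le => //.
  exact: cf_expansion_itv_closed x'a.
exact: cf_expansion_itv_closed y'b.
Qed.

Lemma diameter_cylinder_le w : all (leq 1) w ->
  (diameter (cylinder w) <= ((cf_denominator w)%:R ^- 2)%:E)%E.
Proof.
move=> pw; apply: ge_ereal_sup => _ [x wx [y wy <-]].
by rewrite lee_fin cylinder_dist.
Qed.

Lemma diameter_pow_set0 s : diameter_pow s (@set0 R) = 0%E.
Proof. by rewrite /diameter_pow eqxx. Qed.

Lemma diameter_pow_cylinder_le s w : 0 <= s -> all (leq 1) w ->
  (diameter_pow s (cylinder w) <= (weight R s w)%:E)%E.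
Proof.
move=> s0 pw; rewrite /diameter_pow; case: eqP => [_|/eqP/set0P[x wx]].
  exact: weight_fin_ge0.
have q0 : 0 < (cf_denominator w)%:R :> R by rewrite ltr0n cf_denominator_gt0.
have -> : (weight R s w)%:E = (((cf_denominator w)%:R ^- 2)%:E `^ s)%E.
  by rewrite poweR_EFin -powR_invn ?ler0n// -powRrM mulNr.
have d0 : (0 <= diameter (cylinder w))%E.
  by apply: ereal_sup_ubound; exists x => //; exists x => //; rewrite subrr normr0.
apply: gt0_ler_poweR => //; last exact: diameter_cylinder_le.
- by rewrite in_itv /= d0 leey.
- by rewrite in_itv /= leey andbT lee_fin invr_ge0 exprn_ge0 ?ltW.
Qed.

End cylinders.

Section upper_bound.
Variables (R : realType) (c : R) (psi : nat -> R).
Hypothesis c_gt0 : 0 < c.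
Hypothesis ln_psi : forall n : nat, (1 <= n)%N ->
  ln (psi n) = c * (Num.floor (Num.sqrt (n%:R : R)))%:~R.
Implicit Types (s t x y e delta : R) (w : seq nat) (a : nat -> nat) (k K n : nat).

(** Only a lower bound on the product is retained; the factor 1/2 absorbs the error in the limit
    defining [L_set]. *)
Definition jump_set k : set (seq nat) :=
  [set w | words 2 w /\ expR (c * k%:R) / 2 <= (nth 0%N w 0 * nth 0%N w 1)%:R].

(* With partial quotients numbered from 1, a_{k^2} a_{k^2+1} followed by the free
   ones up to a_{(k+1)^2-1}; hence the offsets k^2 - 1 below. *)
Definition block_set k : set (seq nat) :=
  cat_set (jump_set k) (words (2 * k - 1)).

(* Chebyshev: the sum with exponent t controls the tail of the sum with
   exponent s, so no count of the pairs with a given product is needed. *)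
Lemma word_sum_jump_le s t k : 1 / 2 < t -> t <= s ->
  (word_sum R s (jump_set k) <=
   ((expR (c * k%:R) / 2) `^ (- (2 * (s - t))) * cf_partition R t 2)%:E)%E.
Proof.
move=> t2 ts; set T := expR _ / 2; have T0 : 0 < T by rewrite divr_gt0// expR_gt0.
rewrite EFinM -cf_partitionE// -esum_mull ?powR_gt0//; last exact: weight_fin_ge0.
apply: (@le_trans _ _ (\esum_(w in jump_set k)
    ((T `^ (- (2 * (s - t))))%:E * (weight R t w)%:E))%E); last first.
  by apply: esum_subset => w [].
apply: le_esum => w [[pw sw] Tw]; rewrite -EFinM lee_fin.
have q0 : 0 < (cf_denominator w)%:R :> R by rewrite ltr0n cf_denominator_gt0.
have -> : weight R s w = (cf_denominator w)%:R `^ (- (2 * (s - t))) * weight R t w.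
  rewrite /weight -powRD; last by rewrite (gt_eqF q0) implybT.
  by congr (_ `^ _); ring.
rewrite ler_wpM2r ?weight_ge0// !powRN lef_pV2 ?posrE ?powR_gt0//.
apply: ge0_ler_powR; rewrite ?nnegrE ?(ltW T0) ?(ltW q0)//; first lra.
apply: (le_trans Tw); rewrite ler_nat.
case: w pw sw {Tw q0} => [|d [|d' [|]]]//= _ _.
by rewrite /cf_denominator /=; lia.
Qed.

(** As [t] tends to 1/2, the coefficient of [k] tends to [2 (P(s) - c (s - 1/2))], which is negative
    above the root. The other terms do not depend on [k]. *)
Lemma word_sum_block_le s t k : 1 / 2 < t -> t <= s -> (0 < k)%N ->
  (word_sum R s (block_set k) <=
   (expR (2 * (s - t) * ln 2 + ln (cf_partition R t 2) + ln (4 `^ s) - rpressure s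
     + k%:R * (2 * (rpressure s - c * (s - t)))))%:E)%E.
Proof.
move=> t2 ts k0; have s2 : 1 / 2 < s by lra.
apply: le_trans (word_sum_cat _ _ _ _ _ _ _ _ _ (word_sum_jump_le s t k t2 ts)
   (_ : (_ <= (cf_partition R s (2 * k - 1))%:E)%E)) _; first by lra.
- by move=> w [[]].
- by move=> w [].
- by rewrite cf_partitionE.
rewrite lee_fin -[X in X * _]lnK; last first.
  by rewrite posrE mulr_gt0 ?powR_gt0 ?divr_gt0 ?expR_gt0 ?cf_partition_gt0.
rewrite -[cf_partition R s _]lnK ?posrE ?cf_partition_gt0// -expRD ler_expR.
rewrite lnM ?posrE ?powR_gt0 ?divr_gt0 ?expR_gt0 ?cf_partition_gt0//.
rewrite ln_powR ln_div ?posrE ?expR_gt0// expRK.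
have /andP[_ h] := rpressure_slope _ s (2 * k - 1) s2.
have kE : (2 * k - 1)%:R = 2 * k%:R - 1 :> R by rewrite natrB ?natrM//; lia.
rewrite kE in h.
have -> : - (2 * (s - t)) * (c * k%:R - ln 2) + ln (cf_partition R t 2) +
    ln (cf_partition R s (2 * k - 1)) = 2 * (s - t) * ln 2 + ln (cf_partition R t 2)
     - k%:R * (2 * (c * (s - t))) + ln (cf_partition R s (2 * k - 1)) by ring.
have -> : 2 * (s - t) * ln 2 + ln (cf_partition R t 2) + ln (4 `^ s) - rpressure s
     + k%:R * (2 * (rpressure s - c * (s - t))) =
    2 * (s - t) * ln 2 + ln (cf_partition R t 2) - k%:R * (2 * (c * (s - t))) +
     ((2 * k%:R - 1) * rpressure s + ln (4 `^ s)) by ring.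
by rewrite lerD2l.
Qed.

Lemma eventually_word_sum_block_le_half s : 1 / 2 < s -> rpressure s < c * (s - 1 / 2) ->
  exists k1, (0 < k1)%N /\ forall k, (k1 <= k)%N ->
    (word_sum R s (block_set k) <= (2^-1)%:E)%E.
Proof.
move=> s2 sP.
have [t [t2 ts tP]] : exists t, [/\ 1 / 2 < t, t <= s & rpressure s < c * (s - t)].
  (* [t] is chosen with [c (s - t) = v], halfway between the pressure and the line; the maximum with
     0 guarantees [t <= s]. *)
  pose v := (Num.max (rpressure s) 0 + c * (s - 1 / 2)) / 2.
  have cs : 0 < c * (s - 1 / 2) by rewrite mulr_gt0// subr_gt0.
  have m1 : rpressure s <= Num.max (rpressure s) 0 by rewrite le_max lexx.
  have m2 : 0 <= Num.max (rpressure s) 0 by rewrite le_max lexx orbT.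
  have m3 : Num.max (rpressure s) 0 < c * (s - 1 / 2) by rewrite gt_max sP.
  exists (s - v / c); split.
  - have : v / c < s - 1 / 2 by rewrite ltr_pdivrMr// /v; lra.
    lra.
  - by rewrite lerBlDr lerDl divr_ge0 ?(ltW c_gt0)// /v; lra.
  - have -> : c * (s - (s - v / c)) = v by field; rewrite gt_eqF.
    by rewrite /v; lra.
set A := 2 * (s - t) * ln 2 + ln (cf_partition R t 2) + ln (4 `^ s) - rpressure s.
pose d := 2 * (c * (s - t) - rpressure s).
have d0 : 0 < d by rewrite /d; lra.
exists (Num.truncn ((A + ln 2) / d)).+1; split => // k k1.
apply: (le_trans (word_sum_block_le s t k t2 ts _)); first by lia.
rewrite lee_fin -/A -[2^-1]lnK ?posrE// ler_expR lnV ?posrE//.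
have : (A + ln 2) / d < k%:R by apply: lt_le_trans (truncnS_gt _) _; rewrite ler_nat.
rewrite ltr_pdivrMr// /d => h.
have -> : k%:R * (2 * (rpressure s - c * (s - t))) =
  - (k%:R * (2 * (c * (s - t) - rpressure s))) by ring.
lra.
Qed.

(** The jumps of a point of [L_set] are controlled only from some unknown index [K] on; the digits
    before are free, and the cover ranges over all [K]. *)
Fixpoint admissible_words K n : set (seq nat) :=
  if n is n'.+1 then cat_set (admissible_words K n') (block_set (K + n'))
  else words (K ^ 2 - 1).

Lemma block_set_words k : (0 < k)%N -> block_set k `<=` words (2 * k).+1.
Proof.
move=> k0 _ [u [[pu su] _] [v [pv sv] <-]].
by split; rewrite ?all_cat ?pu// size_cat su sv; lia.
Qed.

Lemma admissible_words_words K n : (0 < K)%N ->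
  admissible_words K n `<=` words ((K + n) ^ 2 - 1).
Proof.
move=> K0; elim: n => [|n IH]; first by rewrite addn0.
move=> _ [u /IH[pu su] [v /block_set_words vb <-]].
have [|pv sv] := vb; first by lia.
by split; rewrite ?all_cat ?pu// size_cat su sv; nia.
Qed.

Lemma word_sum_admissible_le s k1 K n : 1 / 2 < s -> (0 < K)%N -> (k1 <= K)%N ->
  (forall k, (k1 <= k)%N -> (word_sum R s (block_set k) <= (2^-1)%:E)%E) ->
  (word_sum R s (admissible_words K n) <=
    (cf_partition R s (K ^ 2 - 1) * 2^-1 ^+ n)%:E)%E.
Proof.
move=> s2 K0 k1K H; elim: n => [|n IH].
  by rewrite expr0 mulr1 cf_partitionE.
rewrite exprSr mulrA; apply: word_sum_cat; first by lra.
- by move=> w /admissible_words_words -/(_ K0)[].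
- by move=> w /block_set_words[|//]; lia.
- exact: IH.
- by apply: H; lia.
Qed.

Lemma mkseq_admissible a K n : (forall i, 0 < a i)%N -> (0 < K)%N ->
  (forall k, (K <= k)%N -> expR (c * k%:R) / 2 <= (a (k ^ 2 - 1) * a (k ^ 2))%N%:R) ->
  admissible_words K n (mkseq a ((K + n) ^ 2 - 1)).
Proof.
move=> a0 K0 H; elim: n => [|n IH].
  by rewrite addn0; split; rewrite ?mkseq_pos// size_mkseq.
set k := (K + n)%N in IH *.
have kK : (K <= k)%N by rewrite leq_addr.
have -> : ((K + n.+1) ^ 2 - 1 = (k ^ 2 - 1) + (2 + (2 * k - 1)))%N by rewrite /k; nia.
rewrite mkseqD; exists (mkseq a (k ^ 2 - 1)) => //.
exists (mkseq (fun i => a (k ^ 2 - 1 + i)%N) (2 + (2 * k - 1))) => //.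
rewrite mkseqD; eexists; last first.
  eexists; last by reflexivity.
  by split; rewrite ?mkseq_pos// size_mkseq.
split; first by split; rewrite ?mkseq_pos// size_mkseq.
rewrite /= addn0 addn1; have -> : ((k ^ 2 - 1).+1 = k ^ 2)%N by nia.
exact: H.
Qed.

Lemma L_set_jumps x : L_set psi x -> exists a, cf_expansion x a /\
  exists K, forall k, (K <= k)%N ->
    expR (c * k%:R) / 2 <= (a (k ^ 2 - 1) * a (k ^ 2))%N%:R.
Proof.
move=> [x01 irx Lx].
have [a xa] := irrational_cf_expansion _ _ x01 irx.
exists a; split => //.
pose ec := expR (- c).
have ec0 : 0 < ec by exact: expR_gt0.
have ec1 : ec < 1 by rewrite expR_lt1 oppr_lt0.
(* Small enough for [(1 + eta) e^(-c) < 1 - eta], which excludes the old maximum, and for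
   [1 - eta >= 1/2]. *)
pose eta := (1 - ec) / 4.
have eta0 : 0 < eta by rewrite /eta; lra.
move/cvgrPdist_lt : Lx => /(_ eta eta0) [N _ HN].
have Hn k n : (N <= n)%N -> (1 <= n)%N -> (k ^ 2 <= n < k.+1 ^ 2)%N ->
    (1 - eta) * expR (c * k%:R) < (max_consecutive_product x n)%:R /\
    (max_consecutive_product x n)%:R < (1 + eta) * expR (c * k%:R).
  move=> Nn n1 kn; have := HN n Nn; rewrite /= (psiE _ _ _ c_gt0 ln_psi k)//.
  have e0 := expR_gt0 (c * k%:R).
  by rewrite distrC ltr_distl ltr_pdivrMr// ltr_pdivlMr// => /andP[].
exists N.+2 => k Nk.
have [h1 _] := Hn k (k ^ 2)%N ltac:(nia) ltac:(nia) ltac:(nia).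
have [_ h2] := Hn k.-1 (k ^ 2 - 1)%N ltac:(nia) ltac:(nia) ltac:(nia).
have ek : expR (c * k.-1%:R) = ec * expR (c * k%:R).
  rewrite /ec -expRD; congr expR.
  have -> : k%:R = k.-1%:R + 1 :> R by rewrite natr1 prednK//; lia.
  by ring.
have ek0 := expR_gt0 (c * k%:R).
have mE : max_consecutive_product x (k ^ 2)%N =
    maxn (max_consecutive_product x (k ^ 2 - 1)%N) (a (k ^ 2 - 1) * a (k ^ 2))%N.
  have mS m : max_consecutive_product x m.+1 =
      maxn (max_consecutive_product x m) (a m * a m.+1)%N.
    by rewrite /max_consecutive_product big_ord_recr /= (partial_quotientP _ _ _ xa).
  by have := mS (k ^ 2 - 1)%N; have -> : ((k ^ 2 - 1).+1 = k ^ 2)%N by nia.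
move: h1; rewrite mE.
have [le1|lt1] := leqP (max_consecutive_product x (k ^ 2 - 1)%N) (a (k ^ 2 - 1) * a (k ^ 2))%N.
  by move=> h1; rewrite ler_pdivrMr//; rewrite /eta in h1; nra.
move=> h1; exfalso; move: (lt_trans h1 h2); rewrite ek mulrA ltr_pM2r// /eta; nra.
Qed.

Theorem hausdorff_measure_L_set s : 1 / 2 < s -> rpressure s < c * (s - 1 / 2) ->
  hausdorff_measure s (L_set psi) = 0%E.
Proof.
move=> s2 sP; have [k1 [k10 Hk1]] := eventually_word_sum_block_le_half s s2 sP.
have dp0 := diameter_pow_ge0 R s.
suff main e delta : 0 < e -> 0 < delta ->
    (hausdorff_premeasure s delta (L_set psi) <= e%:E)%E.
  apply/eqP; rewrite eq_le; apply/andP; split.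
    apply: ge_ereal_sup => _ [delta d0 <-].
    by apply/lee_addgt0Pr => e e0; rewrite add0e; exact: main.
  apply: (@le_trans _ _ (hausdorff_premeasure s 1 (L_set psi))).
    apply: le_ereal_inf_tmp => _ [U _ <-]; apply: nneseries_ge0 => i _ _; exact: dp0.
  by apply: ereal_sup_ubound; exists 1 => //=.
move=> e0 d0.
have /choice[nK nKP] : forall K, exists n, (k1 <= K)%N ->
    (word_sum R s (admissible_words K n) <= (e / (2 ^ K.+1)%:R)%:E)%E /\
    delta^-1 < ((K + n) ^ 2 - 1)%N%:R.
  move=> K; have [k1K|Kk1] := leqP k1 K; last by exists 0%N.
  set z := cf_partition R s (K ^ 2 - 1).
  have z0 : 0 < z by exact: cf_partition_gt0.
  set eK := e / _; have eK0 : 0 < eK by rewrite divr_gt0// ltr0n expn_gt0.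
  (* Since [n < 2^n], the first bound makes the cost at most [eK]; the second makes the words long
     enough for diameters below [delta]. *)
  pose n := maxn (Num.truncn (z / eK)).+1 (Num.truncn delta^-1).+1.
  exists n => _; split.
    apply: (le_trans (word_sum_admissible_le s k1 K n s2 _ k1K Hk1)); first by lia.
    rewrite lee_fin -/z exprVn ler_pdivrMr ?exprn_gt0// mulrC -ler_pdivrMr//.
    apply: (@le_trans _ _ (n%:R)); last by rewrite -natrX ler_nat ltnW// ltn_expl.
    by apply: (le_trans (ltW (truncnS_gt _))); rewrite ler_nat leq_maxl.
  apply: (lt_le_trans (truncnS_gt _)); rewrite ler_nat.
  apply: (@leq_trans n); [by rewrite leq_maxr|nia].
pose adm := [set p : nat * seq nat | (k1 <= p.1)%N /\ admissible_words p.1 (nK p.1) p.2].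
have adm_pos p : adm p -> all (leq 1) p.2 /\ size p.2 = ((p.1 + nK p.1) ^ 2 - 1)%N.
  by move=> [k1p /admissible_words_words[|//]]; lia.
(* The pairs of an index [K] and an admissible word are enumerated by their codes; all other codes
   give the empty set, which costs nothing. *)
pose U i : set R := if pickle_inv i is Some p then
  (if p \in adm then cylinder R p.2 else set0) else set0.
have UP i : U i = set0 \/ exists p, [/\ pickle_inv i = Some p, adm p & U i = cylinder R p.2].
  rewrite /U; case: (pickle_inv i) => [p|]; last by left.
  by case: ifPn => [/set_mem pa|]; [right; exists p|left].
apply: (@le_trans _ _ (\sum_(0 <= i <oo) diameter_pow s (U i))%E).
  apply: ereal_inf_lbound; exists U => //; split.
    move=> x /L_set_jumps[a [xa [K aK]]].
    pose K' := maxn K k1.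
    pose w := mkseq a ((K' + nK K') ^ 2 - 1).
    have aw : adm (K', w).
      split; first by rewrite /= leq_maxr.
      rewrite /=; apply: mkseq_admissible; [by case: xa|by rewrite /K'; lia|].
      by move=> k kK'; apply: aK; rewrite /K' in kK'; lia.
    exists (pickle (K', w)) => //; rewrite /U pickleK_inv ifT; last exact/mem_set.
    by exists a => //; rewrite /w size_mkseq.
  move=> i; have [->|[p [_ pa ->]]] := UP i.
    by apply: ge_ereal_sup => _ [x []].
  have [pp sp] := adm_pos p pa.
  apply: (le_trans (diameter_cylinder_le _ _ pp)); rewrite lee_fin ltW//.
  apply: cf_denominator_sqrV_lt => //; rewrite sp.
  by have [] := nKP p.1 pa.1.
rewrite nneseries_esumT; last by move=> i; exact: dp0.
apply: (@le_trans _ _ (\esum_(p in adm) (weight R s p.2)%:E)%E).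
  pose S := [set i | exists2 p, pickle_inv i = Some p & adm p].
  have -> : (\esum_(i in [set: nat]) diameter_pow s (U i) =
      \esum_(i in S) diameter_pow s (U i))%E.
    rewrite [RHS]esum_mkcond; apply: eq_esum => i _; case: ifPn => // /negP iS.
    have [->|[p [pi pa _]]] := UP i; first exact: diameter_pow_set0.
    by exfalso; apply: iS; apply/mem_set; exists p.
  apply: (@esum_inj_le _ _ _ _ _ (fun i => odflt (0%N, [::]) (pickle_inv i))) => [i j|i [p pi pa]].
    rewrite !inE => -[p pi _] [q qj _]; rewrite pi qj /= => pq.
    have := @pickle_invK (nat * seq nat)%type i; have := @pickle_invK (nat * seq nat)%type j.
    by rewrite pi qj /= pq => -> ->.
  rewrite pi /=; split=> //; have [pp _] := adm_pos p pa.
  have [->|[q [qi _ ->]]] := UP i; first by rewrite diameter_pow_set0 weight_fin_ge0.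
  by move: qi; rewrite pi => -[<-]; apply: diameter_pow_cylinder_le => //; lra.
apply: (@le_trans _ _ (\sum_(0 <= K <oo) (e / (2 ^ K.+1)%:R)%:E)%E).
  have eK0 K : (0 <= (e / (2 ^ K.+1)%:R)%:E)%E by rewrite lee_fin divr_ge0 ?(ltW e0).
  rewrite nneseries_esumT//.
  have -> : adm = [set K | (k1 <= K)%N] `*`` (fun K => admissible_words K (nK K)) by [].
  rewrite -(@esum_esum _ _ _ [set K | (k1 <= K)%N] (fun K => admissible_words K (nK K))
    (fun _ w => (weight R s w)%:E)); last by move=> K w _ _; exact: weight_fin_ge0.
  apply: (@le_trans _ _ (\esum_(K in [set K | (k1 <= K)%N]) (e / (2 ^ K.+1)%:R)%:E)%E).
    by apply: le_esum => K k1K; have [] := nKP K k1K.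
  exact: esum_subset.
have := @epsilon_trick R (fun=> 0%E) e xpredT (fun=> lexx _) (ltW e0).
rewrite (_ : (\sum_(0 <= i <oo) 0 = 0 :> \bar R)%E); last by rewrite eseries0.
by rewrite add0e; under eq_eseriesr do rewrite add0e.
Qed.

End upper_bound.

(** * Mass distribution on sequences of blocks *)

Lemma nat_square_split (i : nat) : exists k j,
  (j < (2 * k).+1 /\ i = k ^ 2 + j)%N.
Proof.
elim: i => [|i [k [j [jk ->]]]]; first by exists 0%N, 0%N.
have [h|h] := ltnP j.+1 (2 * k).+1; first by exists k, j.+1; split => //; lia.
by exists k.+1, 0%N; split => //; nia.
Qed.

Section block_concatenation.
Local Open Scope nat_scope.
Variable b : nat -> seq nat.

(** When block [k] has length [2 k + 1], the first [i + 1] blocks have total length [(i + 1)^2 > i],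
    so the default 0 is never read. *)
Definition concat_blocks (i : nat) : nat := nth 0 (flatten (mkseq b i.+1)) i.

Hypothesis size_b : forall k, size (b k) = (2 * k).+1.

Lemma flatten_mkseqS k : flatten (mkseq b k.+1) = flatten (mkseq b k) ++ b k.
Proof. by rewrite mkseqS flatten_rcons. Qed.

Lemma size_flatten_mkseq k : size (flatten (mkseq b k)) = k ^ 2.
Proof. by elim: k => // k IH; rewrite flatten_mkseqS size_cat IH size_b; nia. Qed.

Lemma concat_blocksE k i : i < k ^ 2 ->
  concat_blocks i = nth 0 (flatten (mkseq b k)) i.
Proof.
have H m n : m <= n -> i < m ^ 2 ->
    nth 0 (flatten (mkseq b m)) i = nth 0 (flatten (mkseq b n)) i.
  move=> mn im; rewrite -(subnKC mn) mkseqD flatten_cat nth_cat.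
  by rewrite size_flatten_mkseq im.
move=> ik; rewrite /concat_blocks.
have [h|h] := leqP k i.+1; first by rewrite -(H k i.+1).
by rewrite (H i.+1 k)//; [exact: ltnW|nia].
Qed.

Lemma mkseq_concat_blocks k : mkseq concat_blocks (k ^ 2) = flatten (mkseq b k).
Proof.
apply: (@eq_from_nth _ 0) => [|i]; first by rewrite size_mkseq size_flatten_mkseq.
by rewrite size_mkseq => ik; rewrite nth_mkseq// (concat_blocksE k).
Qed.

Lemma concat_blocks_block k j : j < (2 * k).+1 ->
  concat_blocks (k ^ 2 + j) = nth 0 (b k) j.
Proof.
move=> jk; rewrite (concat_blocksE k.+1); last by nia.
rewrite flatten_mkseqS nth_cat size_flatten_mkseq ifF; last by apply/negbTE; rewrite -leqNgt leq_addr.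
by rewrite addKn.
Qed.

Lemma concat_blocks_split i : exists k j,
  [/\ j < (2 * k).+1, i = k ^ 2 + j & concat_blocks i = nth 0 (b k) j].
Proof.
have [k [j [jk ->]]] := nat_square_split i.
by exists k, j; split => //; exact: concat_blocks_block.
Qed.

Lemma concat_blocks_gt0 : (forall k, all (leq 1) (b k)) -> forall i, 0 < concat_blocks i.
Proof.
move=> pb i; have [k [j [jk _ ->]]] := concat_blocks_split i.
by apply: (allP (pb k)); rewrite mem_nth// size_b.
Qed.

End block_concatenation.

(** * Mass of block prefixes compared with distances between points *)

Section block_sets.
Variable R : realType.
Variables (B : nat -> seq (seq nat)) (s A rho : R).
Hypothesis B_uniq : forall k, uniq (B k).
Hypothesis B_pos : forall k w, w \in B k -> all (leq 1) w.
Hypothesis B_size : forall k w, w \in B k -> size w = (2 * k).+1.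
Hypothesis B_den : forall k w, w \in B k -> (cf_denominator w)%:R <= A * rho ^+ k.
Hypothesis A_ge1 : 1 <= A.
Hypothesis rho_ge1 : 1 <= rho.
Hypothesis s_gt0 : 0 < s.

Let S k := \sum_(w <- B k) weight R s w.

Hypothesis S_gt0 : forall k, 0 < S k.
Hypothesis S_large : exists k0, forall k, (k0 <= k)%N ->
  2 * 4 `^ s * (rho ^+ 5) `^ s <= S k.

Let p k w := weight R s w / S k.

Definition block_point (b : nat -> seq nat) : R :=
  get [set x | cf_expansion x (concat_blocks b)].

Lemma block_pointP b : is_branch _ B b ->
  cf_expansion (block_point b) (concat_blocks b).
Proof.
move=> bB; apply: (@getPex _ [set x : R | cf_expansion x (concat_blocks b)]); apply: cf_expansion_exists.
by apply: concat_blocks_gt0 => k; [apply: (B_size k); exact: bB|exact: B_pos (bB k)].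
Qed.

(** The exponent is [k + 1] because the three digits that separate two points may run over from
    block [k] into the next one. *)
Let Q k := A * rho ^+ k.+1.

Let Q_ge1 k : 1 <= Q k.
Proof. by rewrite mulr_ege1// exprn_ege1. Qed.

Let branch_size b : is_branch _ B b -> forall k, size (b k) = (2 * k).+1.
Proof. by move=> bB k; exact: B_size (bB k). Qed.

Let branch_digit b k i : is_branch _ B b -> (i < k.+2 ^ 2)%N ->
  (concat_blocks b i)%:R <= Q k.
Proof.
move=> bB ik; have [m [j [jm iE ->]]] := concat_blocks_split b (branch_size b bB) i.
have mk : (m <= k.+1)%N by nia.
apply: (@le_trans _ _ (cf_denominator (b m))%:R).
  rewrite ler_nat digit_le_cf_denominator ?(B_pos m)//.
  by rewrite mem_nth// branch_size.
apply: le_trans (B_den _ _ (bB m)) _.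
by rewrite ler_wpM2l ?(le_trans ler01)// ler_weXn2l.
Qed.

(** Past the common word [W ++ u] the first digits differ and the tails are at least [1 / (16 Q^3)]
    apart. Returning to the points costs [4 q^2] with [q <= 2 q_W Q], hence [256 Q^5]. *)
Lemma block_point_separation b g k : is_branch _ B b -> is_branch _ B g ->
  (forall j, (j < k)%N -> b j = g j) -> b k <> g k ->
  1 <= 256 * Q k ^+ 5 * (cf_denominator (flatten (mkseq b k)))%:R ^+ 2 *
       `|block_point b - block_point g|.
Proof.
move=> bB gB bg bgk.
set x := block_point b; set y := block_point g; set W := flatten (mkseq b k).
have sb := branch_size b bB; have sg := branch_size g gB.
have [j [jk take_eq nth_neq]] : exists j, [/\ (j < (2 * k).+1)%N,
    take j (b k) = take j (g k) & nth 0%N (b k) j <> nth 0%N (g k) j].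
  have exj : exists j, nth 0%N (b k) j != nth 0%N (g k) j.
    apply: contrapT => H; apply: bgk; apply: (@eq_from_nth _ 0%N).
      by rewrite sb sg.
    by move=> j _; apply/eqP; apply: contrapT => /negP ?; apply: H; exists j.
  have [j jneq jmin] := ex_minnP exj; exists j; split; last exact/eqP.
    by rewrite ltnNge; apply: contra jneq => h; rewrite !nth_default ?sb ?sg.
  apply: (@eq_from_nth _ 0%N); first by rewrite !size_take sb sg.
  move=> i; rewrite size_take => ij.
  have {}ij : (i < j)%N by move: ij; case: ifP => // /negbT; rewrite -leqNgt; lia.
  rewrite !nth_take//; apply/eqP; apply: contraTT ij => /jmin.
  by rewrite -leqNgt.
set u := take j (b k).
have WE : W = flatten (mkseq g k).
  rewrite /W; congr flatten; apply/eq_in_map => i; rewrite mem_iota => /andP[_ ik].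
  exact: bg.
have prefixE f : is_branch _ B f -> W = flatten (mkseq f k) -> u = take j (f k) ->
    mkseq (concat_blocks f) (k ^ 2 + j) = W ++ u.
  move=> fB WF uf; have sf := branch_size f fB.
  apply: (@eq_from_nth _ 0%N).
    rewrite size_mkseq size_cat WF size_flatten_mkseq// uf size_takel// sf.
    exact: ltnW.
  move=> i; rewrite size_mkseq => ik; rewrite nth_mkseq// (concat_blocksE f sf k.+1); last by nia.
  rewrite flatten_mkseqS -WF !nth_cat; case: ifP => // /negbT iW.
  rewrite uf nth_take// WF size_flatten_mkseq//.
  by move: iW; rewrite WF size_flatten_mkseq//; lia.
have [x' x'b xE] := cf_expansion_tail _ _ _ (k ^ 2 + j) (block_pointP b bB).
have [y' y'g yE] := cf_expansion_tail _ _ _ (k ^ 2 + j) (block_pointP g gB).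
have bE := prefixE b bB erefl erefl; have gE := prefixE g gB WE take_eq.
have bpos : all (leq 1) (b k) by exact: B_pos (bB k).
have pWu : all (leq 1) (W ++ u).
  rewrite -bE; apply: mkseq_pos; apply: concat_blocks_gt0 => // m; exact: B_pos (bB m).
have /andP[pW pu] : all (leq 1) W && all (leq 1) u by rewrite -all_cat.
have h1 : `|x' - y'| <= 4 * (cf_denominator (W ++ u))%:R ^+ 2 * `|x - y|.
  rewrite /x /y xE yE bE gE; apply: cf_tail_dist_ge => //.
    exact: cf_expansion_itv_closed x'b.
  exact: cf_expansion_itv_closed y'g.
pose D := Num.truncn (Q k).
have DQ : D%:R <= Q k by have /andP[] := truncn_itv (le_trans ler01 (Q_ge1 k)).
have h2 : 1 <= 16 * D%:R ^+ 3 * `|x' - y'|.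
  apply: (cf_expansion_dist_head _ _ _ _ _ _ x'b y'g).
  - by rewrite addn0 !concat_blocks_block.
  - move=> i i3; rewrite truncn_ge_nat ?(le_trans ler01)//.
    by apply: branch_digit => //; nia.
  - move=> i i3; rewrite truncn_ge_nat ?(le_trans ler01)//.
    by apply: branch_digit => //; nia.
have h3 : (cf_denominator (W ++ u))%:R <= 2 * (cf_denominator W)%:R * Q k.
  apply: (@le_trans _ _ (2 * (cf_denominator W)%:R * (cf_denominator u)%:R)).
    by rewrite -!natrM ler_nat cf_denominator_cat_le.
  rewrite ler_wpM2l ?mulr_ge0//.
  apply: (@le_trans _ _ (cf_denominator (b k))%:R).
    rewrite ler_nat -(cat_take_drop j (b k)) -/u cf_denominator_le_cat//.
    by move: bpos; rewrite -{1}(cat_take_drop j (b k)) all_cat => /andP[].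
  apply: le_trans (B_den _ _ (bB k)) _.
  by rewrite ler_wpM2l ?(le_trans ler01)// ler_weXn2l.
apply: (le_trans h2).
have Qk := Q_ge1 k.
apply: (@le_trans _ _ (16 * Q k ^+ 3 * (4 * (2 * (cf_denominator W)%:R * Q k) ^+ 2 * `|x - y|))).
  apply: ler_pM => //; try by rewrite mulr_ge0// exprn_ge0.
    by rewrite ler_wpM2l// lerXn2r ?nnegrE// (le_trans ler01).
  apply: (le_trans h1); rewrite ler_wpM2r// ler_wpM2l// lerXn2r ?nnegrE//.
  by apply: mulr_ge0; [exact: mulr_ge0|exact: le_trans ler01 Qk].
by rewrite le_eqVlt; apply/orP; left; apply/eqP; ring.
Qed.

Let branch_prefix_pos b k : is_branch _ B b -> all (leq 1) (flatten (mkseq b k)).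
Proof.
move=> bB; rewrite -mkseq_concat_blocks; last exact: branch_size.
apply: mkseq_pos; apply: concat_blocks_gt0; first exact: branch_size.
by move=> m; exact: B_pos (bB m).
Qed.

(** The factor [4^s] is the cost of appending block [j], and [S j] normalises its weights. *)
Let t k := \prod_(j < k) (4 `^ s / S j).

Let t_gt0 k : 0 < t k.
Proof. by apply: prodr_gt0 => j _; rewrite divr_gt0 ?powR_gt0. Qed.

Let node_mass_le b k : is_branch _ B b ->
  node_mass _ _ p 0 (mkseq b k) <= t k * weight R s (flatten (mkseq b k)).
Proof.
move=> bB; elim: k => [|k IH].
  by rewrite /t big_ord0 mul1r weight_nil.
rewrite mkseqS node_mass_rcons add0n size_mkseq flatten_rcons /t big_ord_recr /= -/(t k).
have Sk := S_gt0 k.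
have pf := branch_prefix_pos b k bB.
have := weight_cat_ge R s _ _ (ltW s_gt0) pf (B_pos _ _ (bB k)).
set W := flatten _; set wW := weight _ _ W; set wb := weight _ _ (b k); set wc := weight _ _ _ => h.
apply: (@le_trans _ _ (t k * wW * (wb / S k))).
  by rewrite ler_wpM2r// divr_ge0 ?weight_ge0// ltW.
have -> : t k * wW * (wb / S k) = t k / S k * (wW * wb) by ring.
have -> : t k * (4 `^ s / S k) * wc = t k / S k * (4 `^ s * wc) by ring.
by rewrite ler_wpM2l// divr_ge0 ?ltW.
Qed.

Lemma block_mass_distribution : exists2 C, 0 < C & forall U : nat -> set R,
  (forall b, is_branch _ B b -> exists i, U i (block_point b)) ->
  ((C^-1)%:E <= \sum_(0 <= i <oo) diameter_pow s (U i))%E.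
Proof.
have [k0 Hk0] := S_large.
have A0 : 0 <= A by exact: le_trans ler01 A_ge1.
(* The constant of the separation estimate at level [k]. One level multiplies it by
   [4^s rho^(5s) / S k], eventually at most 1, so a finite sum of first values bounds it. The factor
   2 in [S_large] makes [t] decay geometrically, so that masses vanish along branches. *)
pose u k := t k * (256 * Q k ^+ 5) `^ s.
have Q0 k : 0 < Q k by exact: lt_le_trans ltr01 (Q_ge1 k).
have V_gt0 k : 0 < 256 * Q k ^+ 5.
  by apply: mulr_gt0; [rewrite ltr0n|apply: exprn_gt0; exact: Q0].
have u_gt0 k : 0 < u k.
  by apply: mulr_gt0; [exact: t_gt0|apply: powR_gt0; exact: V_gt0].
have rho0 : 0 < rho by exact: lt_le_trans ltr01 rho_ge1.
have rs1 : 1 <= (rho ^+ 5) `^ s.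
  have <- : 1 `^ s = 1 :> R by rewrite powR1.
  apply: ge0_ler_powR; rewrite ?nnegrE ?(ltW s_gt0)// ?exprn_ege1//.
  by rewrite exprn_ge0// ltW.
have tS k : t k.+1 = t k * (4 `^ s / S k) by rewrite /t big_ord_recr.
have t_half k : (k0 <= k)%N -> t k.+1 <= t k / 2.
  move=> kk; rewrite tS ler_wpM2l ?(ltW (t_gt0 k))// ler_pdivrMr// ler_pdivlMl//.
  apply: le_trans (Hk0 k kk); rewrite ler_peMr// mulr_ge0// powR_ge0.
have u_anti k : (k0 <= k)%N -> u k.+1 <= u k.
  move=> kk; rewrite /u tS.
  have -> : 256 * Q k.+1 ^+ 5 = (256 * Q k ^+ 5) * rho ^+ 5 by rewrite /Q !exprSr; ring.
  rewrite (powRM _ (ltW (V_gt0 k)) (exprn_ge0 5 (ltW rho0))).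
  set V := (256 * _) `^ s.
  have -> : t k * (4 `^ s / S k) * (V * (rho ^+ 5) `^ s) =
     t k * V * (4 `^ s * (rho ^+ 5) `^ s / S k) by ring.
  rewrite ler_piMr ?mulr_ge0 ?powR_ge0 ?(ltW (t_gt0 k))// ler_pdivrMr// mul1r.
  apply: le_trans (Hk0 k kk); rewrite -mulrA ler_peMl ?ler1n// mulr_ge0 ?powR_ge0//.
pose C := \sum_(j < k0.+1) u j.
have uC k : u k <= C.
  have uj j : (j < k0.+1)%N -> u j <= C.
    move=> jk; rewrite /C (bigD1 (Ordinal jk))//= lerDl sumr_ge0// => i _.
    exact: ltW.
  have [h|h] := ltnP k k0.+1; first exact: uj.
  rewrite -(subnKC (ltnW h)); elim: (k - k0)%N => [|m IH].
    by rewrite addn0 uj.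
  by rewrite addnS; apply: le_trans IH; apply: u_anti; rewrite leq_addr.
have C0 : 0 < C by apply: lt_le_trans (u_gt0 0%N) (uC 0%N).
exists C => // U cover.
apply: (@mass_distribution _ _ B p block_point) => //.
- by move=> k w; rewrite divr_ge0 ?weight_ge0// ltW.
- by move=> k; rewrite /p -mulr_suml -/(S k) mulfV// gt_eqF.
- exact: ltW.
- move=> b g k bB gB bg bgk; apply: (le_trans (node_mass_le b k bB)).
  have := block_point_separation b g k bB gB bg bgk.
  set q := cf_denominator _; set d := `|_ - _| => sep.
  have q0 : 0 < q%:R :> R.
    by rewrite ltr0n cf_denominator_gt0// branch_prefix_pos.
  have wq : weight R s (flatten (mkseq b k)) <= (256 * Q k ^+ 5) `^ s * d `^ s.
    have d0 : 0 <= d by exact: normr_ge0.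
    have QV := ltW (V_gt0 k).
    rewrite -(powRM _ QV d0) /weight -/q -mulNr powRrM powR_invn ?ler0n//.
    apply: ge0_ler_powR; rewrite ?nnegrE ?(ltW s_gt0) ?invr_ge0 ?exprn_ge0 ?(mulr_ge0 QV d0)//.
     rewrite -[leLHS]mul1r ler_pdivrMr ?exprn_gt0//.
    by apply: (le_trans sep); rewrite le_eqVlt; apply/orP; left; apply/eqP; ring.
  apply: (@le_trans _ _ (u k * d `^ s)).
    by rewrite /u -mulrA ler_wpM2l// ltW.
  by rewrite ler_wpM2r ?powR_ge0.
- move=> b bB e e0.
  have tk m : t (k0 + m)%N <= t k0 * 2^-1 ^+ m.
    elim: m => [|m IH]; first by rewrite addn0 expr0 mulr1.
    rewrite addnS exprSr mulrA; apply: le_trans (t_half _ (leq_addr _ _)) _.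
    by rewrite ler_wpM2r.
  pose m := (Num.truncn (t k0 / e)).+1.
  exists (k0 + m)%N; apply: (le_trans (node_mass_le b _ bB)).
  apply: (@le_trans _ _ (t (k0 + m)%N)).
    rewrite ler_piMr ?(ltW (t_gt0 _))//.
    have pf := branch_prefix_pos b (k0 + m)%N bB.
    have <- : 1%:R `^ (- (2 * s)) = 1 :> R by rewrite powR1.
    by apply: natr_powRN_le => //; [exact: ltW|exact: cf_denominator_gt0].
  apply: (le_trans (tk m)).
  rewrite exprVn ler_pdivrMr ?exprn_gt0// mulrC -ler_pdivrMr//.
  apply: (@le_trans _ _ (m%:R)); last by rewrite -natrX ler_nat ltnW// ltn_expl.
  by rewrite ltW// truncnS_gt.
Qed.

End block_sets.

(** * Words over a finite alphabet *)

Section bounded_words.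
Variable R : realType.
Implicit Types (s beta : R) (M n m : nat) (w : seq nat).

Fixpoint bounded_words M n : seq (seq nat) :=
  if n is n'.+1 then [seq a :: w | a <- iota 1 M, w <- bounded_words M n']
  else [:: [::]].

Lemma mem_bounded_words M n w : (w \in bounded_words M n) =
  (size w == n) && all (fun a => 1 <= a <= M)%N w.
Proof.
elim: n w => [|n IH] w; first by case: w.
apply/allpairsP/idP => [[[a v] /= [aM vn ->]]|].
  by move: aM vn; rewrite mem_iota IH /= eqSS => aM /andP[-> ->]; rewrite andbT; lia.
case: w => [//|a v] /=; rewrite eqSS => /and3P[sv aM vM].
exists (a, v); split => //=; first by rewrite mem_iota; lia.
by rewrite IH sv.
Qed.

Lemma bounded_words_uniq M n : uniq (bounded_words M n).
Proof.
elim: n => // n IH /=; apply: allpairs_uniq => //; first exact: iota_uniq.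
by move=> [a v] [b w] _ _ /= [-> ->].
Qed.

Lemma bounded_wordsP M n w : w \in bounded_words M n ->
  [/\ size w = n, all (leq 1) w & all (geq M) w].
Proof.
rewrite mem_bounded_words => /andP[/eqP sw /allP wM]; split => //;
  by apply/allP => a /wM /andP[].
Qed.

Definition bounded_sum s M n : R := \sum_(w <- bounded_words M n) weight R s w.

Lemma word_sum_seq s (L : seq (seq nat)) : uniq L ->
  word_sum R s [set` L] = (\sum_(w <- L) weight R s w)%:E.
Proof.
move=> uL; rewrite -sumEFin fsbig_seq//; apply: esum_fset.
  exact: finite_seq.
by move=> w _; exact: weight_fin_ge0.
Qed.

Lemma nseq1_bounded_words M n : (0 < M)%N -> nseq n 1%N \in bounded_words M n.
Proof.
move=> M0; rewrite mem_bounded_words size_nseq eqxx /=.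
by apply/allP => a; rewrite mem_nseq => /andP[_ /eqP ->].
Qed.

Lemma bounded_sum_ge_ones s M n : (0 < M)%N ->
  weight R s (nseq n 1%N) <= bounded_sum s M n.
Proof.
move=> M0; rewrite /bounded_sum (bigD1_seq (nseq n 1%N)) ?nseq1_bounded_words ?bounded_words_uniq//=.
by rewrite lerDl sumr_ge0// => w _; exact: weight_ge0.
Qed.

Lemma bounded_sum_gt0 s M n : (0 < M)%N -> 0 < bounded_sum s M n.
Proof.
move=> M0; apply: lt_le_trans (bounded_sum_ge_ones s M n M0).
by apply: weight_gt0; have [] := bounded_wordsP _ _ _ (nseq1_bounded_words M n M0).
Qed.

Lemma bounded_sumD s M n m : 0 <= s -> (0 < M)%N ->
  bounded_sum s M n * bounded_sum s M m <= 4 `^ s * bounded_sum s M (n + m).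
Proof.
move=> s0 M0; rewrite -lee_fin !EFinM /bounded_sum -!word_sum_seq ?bounded_words_uniq//.
apply: (@le_trans _ _ ((4 `^ s)%:E *
    word_sum R s (cat_set [set` bounded_words M n] [set` bounded_words M m]))%E).
  apply: (@word_sum_cat_ge _ _ _ _ n) => //.
  - by move=> w /bounded_wordsP[].
  - by move=> w /bounded_wordsP[].
  - by rewrite word_sum_seq ?bounded_words_uniq// lte_fin bounded_sum_gt0.
  - by rewrite word_sum_seq ?bounded_words_uniq// ltry.
apply: lee_wpmul2l; first by rewrite lee_fin powR_ge0.
apply: word_sum_subset => _ [u /= un [v /= vm <-]]; move: un vm.
rewrite !mem_bounded_words size_cat all_cat => /andP[/eqP -> ->] /andP[/eqP -> ->].
by rewrite eqxx.
Qed.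

Lemma exists_bounded_sum_gt s n x : 1 / 2 < s -> x < cf_partition R s n ->
  exists2 M, (0 < M)%N & x < bounded_sum s M n.
Proof.
move=> s2; rewrite -lte_fin -cf_partitionE// => /ereal_sup_gt[_ [F [finF Fn] <-]] xF.
have /finite_seqP[L FL] := finF.
pose M := (\max_(w <- L) \max_(a <- w) a).+1.
exists M => //; rewrite -lte_fin; apply: (lt_le_trans xF).
rewrite /bounded_sum -word_sum_seq ?bounded_words_uniq//.
apply: esum_ge; exists F => //; split => // w Fw /=.
rewrite mem_bounded_words; have [pw ->] := Fn _ Fw; rewrite eqxx /=.
apply/allP => a aw; rewrite (allP pw)//=; apply: leqW.
apply: (@leq_trans (\max_(a <- w) a)); first exact: (@leq_bigmax_seq _ _ _ (fun a => a)).
apply: (@leq_bigmax_seq _ L xpredT (fun w => \max_(a <- w) a)%N) => //.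
by move: Fw; rewrite FL.
Qed.

(** Finite alphabets lose arbitrarily little pressure. For a long enough [m] the full sum over words
    of length [m] exceeds [4^s e^(m beta)], and so does a finite part of it; repeating such words
    then gains [e^(m beta)] each time despite the factor [4^s]. *)
Lemma bounded_sum_growth s beta : 1 / 2 < s -> 0 <= beta -> beta < rpressure s ->
  exists M (kappa : R), [/\ (0 < M)%N, 0 < kappa &
    forall n, kappa * expR (n%:R * beta) <= bounded_sum s M n].
Proof.
move=> s2 b0 bP; have s0 : 0 <= s by lra.
pose m := (Num.truncn (ln (4 `^ s) / (rpressure s - beta))).+1.
have m0 : 0 < m%:R :> R by rewrite ltr0n.
have hm : 4 `^ s * expR (m%:R * beta) < cf_partition R s m.
  have /andP[h _] := rpressure_slope _ s m s2.
  rewrite -[X in _ < X]lnK ?posrE ?cf_partition_gt0//.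
  rewrite -[4 `^ s]lnK ?posrE ?powR_gt0// -expRD ltr_expR.
  apply: lt_le_trans h.
  have : ln (4 `^ s) / (rpressure s - beta) < m%:R by exact: truncnS_gt.
  by rewrite ltr_pdivrMr ?subr_gt0//; lra.
have [M M0 hM] := exists_bounded_sum_gt s m _ s2 hm.
have p4 : 0 < 4 `^ s :> R by rewrite powR_gt0.
have step j : expR ((j * m)%:R * beta) <= bounded_sum s M (j * m).
  elim: j => [|j IH].
    by rewrite mul0n mul0r expR0 /bounded_sum /= big_seq1 weight_nil.
  rewrite mulSnr -(ler_pM2l p4).
  apply: le_trans (bounded_sumD s M (j * m) m s0 M0).
  rewrite natrD mulrDl expRD mulrCA.
  by apply: ler_pM => //; rewrite ?expR_ge0 ?mulr_ge0 ?expR_ge0 ?powR_ge0 ?(ltW hM).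
pose w0 := weight R s (nseq m 1%N).
have w00 : 0 < w0.
  by apply: weight_gt0; have [] := bounded_wordsP _ _ _ (nseq1_bounded_words M m M0).
(* For the remainder of [n] modulo [m]: [4^s] pays for appending it, [w0] bounds its sum from below,
   and [e^(-m beta)] makes up for the missing growth. *)
exists M, ((4 `^ s)^-1 * w0 * expR (- (m%:R * beta))); split => //.
  by rewrite !mulr_gt0 ?invr_gt0 ?expR_gt0.
move=> n; rewrite (divn_eq n m) -(ler_pM2l p4).
apply: le_trans (bounded_sumD s M (n %/ m * m) (n %% m) s0 M0).
have rm : (n %% m < m)%N by rewrite ltn_mod.
have -> : 4 `^ s * ((4 `^ s)^-1 * w0 * expR (- (m%:R * beta)) *
   expR ((n %/ m * m + n %% m)%:R * beta)) =
   w0 * expR ((n %/ m * m + n %% m)%:R * beta - m%:R * beta).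
  by rewrite expRD; field; rewrite gt_eqF.
rewrite mulrC; apply: ler_pM; rewrite ?expR_ge0 ?(ltW w00)//.
  apply: le_trans (step _); rewrite ler_expR natrD.
  have : (n %% m)%:R <= m%:R :> R by rewrite ler_nat ltnW.
  nra.
apply: le_trans (bounded_sum_ge_ones s M (n %% m) M0).
apply: natr_powRN_le => //.
  by apply: cf_denominator_gt0; have [] := bounded_wordsP _ _ _ (nseq1_bounded_words M (n %% m) M0).
have -> : nseq m 1%N = nseq (n %% m) 1%N ++ nseq (m - n %% m) 1%N.
  by rewrite -nseqD subnKC// ltnW.
apply: cf_denominator_le_cat.
by have [] := bounded_wordsP _ _ _ (nseq1_bounded_words M (m - n %% m) M0).
Qed.

End bounded_words.

(** * Lower bound for the dimension *)

Section lower_bound.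
Variables (R : realType) (c : R) (psi : nat -> R).
Hypothesis c_gt0 : 0 < c.
Hypothesis ln_psi : forall n : nat, (1 <= n)%N ->
  ln (psi n) = c * (Num.floor (Num.sqrt (n%:R : R)))%:~R.
Implicit Types (k n i j : nat) (v w : seq nat).

(* Block k occupies the 0-indexed positions k^2, ..., k^2 + 2k, so that its large
   digit n is the partial quotient a_{k^2+1}. The ones around n keep its products
   with both neighbours equal to n. *)
Definition jump_block n v : seq nat := [:: n, 1%N & rcons v 1%N].

Lemma jump_block_inj n m v w : jump_block n v = jump_block m w -> n = m /\ v = w.
Proof. by move=> [-> /rcons_inj[->]]. Qed.

Lemma all_jump_block n v : (0 < n)%N -> all (leq 1) v -> all (leq 1) (jump_block n v).
Proof. by move=> n0 pv; rewrite /= n0 all_rcons pv. Qed.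

Lemma cf_denominator_jump_block n v : (0 < n)%N -> all (leq 1) v ->
  (cf_denominator (jump_block n v) <= 8 * n * cf_denominator v)%N.
Proof.
move=> n0 pv; have h1 : (cf_denominator (rcons v 1) <= 2 * cf_denominator v)%N.
  by rewrite cf_denominator_rcons; have := cf_denominator_pred_le v pv; lia.
have := cf_denominator_cat_le [:: n; 1%N] (rcons v 1).
rewrite /= n0 all_rcons pv => /(_ isT isT).
have -> : cf_denominator [:: n; 1%N] = n.+1 by rewrite /cf_denominator /=; lia.
rewrite -/(jump_block n v); move/leq_trans; apply.
apply: (@leq_trans (2 * n.+1 * (2 * cf_denominator v))%N).
  by rewrite leq_mul2l h1 orbT.
nia.
Qed.

Section blocks.
Variables (M k0 : nat).
Hypothesis M_gt0 : (0 < M)%N.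
Hypothesis k0_gt0 : (0 < k0)%N.
Hypothesis k0_c : 1 <= c * k0%:R.
Hypothesis k0_M : (M ^ 2)%:R <= expR (c * k0%:R).
Hypothesis k0_exp : forall k, (k0 <= k)%N -> 2 * k%:R <= expR (c * k%:R).

Let E k := expR (c * k%:R).

(** The large digits are [jump_base k + i] with [1 <= i <= jump_count k]; they lie above [E k] by a
    relative excess of at most [1/k]. *)
Definition jump_base k := Num.truncn (E k).
Definition jump_count k := Num.truncn (E k / k%:R).

Definition jump_blocks k : seq (seq nat) :=
  [seq jump_block (jump_base k + i) v |
     i <- iota 1 (jump_count k), v <- bounded_words M (2 * k - 2)].

Definition blocks k : seq (seq nat) :=
  if (k0 <= k)%N then jump_blocks k else [:: nseq (2 * k).+1 1%N].

Let E_gt0 k : 0 < E k. Proof. exact: expR_gt0. Qed.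

Lemma jump_blocksP k w : (0 < k)%N -> w \in jump_blocks k -> exists n v,
  [/\ w = jump_block n v, (0 < n)%N, v \in bounded_words M (2 * k - 2),
      E k < n%:R & n%:R <= E k * (1 + k%:R^-1)].
Proof.
move=> k0' /allpairsP[[i v] /= [ic vM ->]]; move: ic; rewrite mem_iota => ic.
exists (jump_base k + i)%N, v; split => //; first by lia.
  apply: lt_le_trans (truncnS_gt _) _; rewrite ler_nat -/(jump_base k) -addn1 leq_add2l; lia.
have /andP[h1 _] := truncn_itv (ltW (E_gt0 k)).
have Ek0 : 0 <= E k / k%:R by rewrite divr_ge0// ltW.
have /andP[h2 _] := truncn_itv Ek0.
rewrite natrD mulrDr mulr1; apply: lerD => //.
by apply: le_trans h2; rewrite ler_nat -/(jump_count k); lia.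
Qed.

Lemma blocks_uniq k : uniq (blocks k).
Proof.
rewrite /blocks; case: ifP => // _; apply: allpairs_uniq.
- exact: iota_uniq.
- exact: bounded_words_uniq.
- by move=> [i v] [j w] _ _ /= /jump_block_inj[/addnI -> ->].
Qed.

Lemma blocks_pos k w : w \in blocks k -> all (leq 1) w.
Proof.
rewrite /blocks; case: ifP => [kk|_]; last first.
  by rewrite inE => /eqP ->; apply/allP => a; rewrite mem_nseq => /andP[_ /eqP ->].
have k0' : (0 < k)%N by lia.
move=> /(jump_blocksP _ _ k0')[n [v [-> n0 /bounded_wordsP[_ pv _] _ _]]].
exact: all_jump_block.
Qed.

Lemma blocks_size k w : w \in blocks k -> size w = (2 * k).+1.
Proof.
rewrite /blocks; case: ifP => [kk|_]; last by rewrite inE => /eqP ->; rewrite size_nseq.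
have k0' : (0 < k)%N by lia.
move=> /(jump_blocksP _ _ k0')[n [v [-> _ /bounded_wordsP[sv _ _] _ _]]].
by rewrite /= size_rcons sv; lia.
Qed.

Let le2E n k : (0 < k)%N -> n%:R <= E k * (1 + k%:R^-1) -> n%:R <= 2 * E k.
Proof.
move=> k0' /le_trans; apply; rewrite mulrC ler_wpM2r ?(ltW (E_gt0 k))//.
have : k%:R^-1 <= 1 :> R by rewrite invf_le1 ?ler1n ?ltr0n.
lra.
Qed.

Let den_jump_block k n v : (0 < k)%N -> (0 < n)%N -> all (leq 1) v ->
  n%:R <= E k * (1 + k%:R^-1) ->
  (cf_denominator (jump_block n v))%:R <= 16 * E k * (cf_denominator v)%:R.
Proof.
move=> k0' n0 pv /(le2E _ _ k0') n2.
apply: (@le_trans _ _ (8 * n * cf_denominator v)%N%:R).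
  by rewrite ler_nat cf_denominator_jump_block.
rewrite !natrM ler_wpM2r//; lra.
Qed.

Lemma blocks_den k w : w \in blocks k ->
  (cf_denominator w)%:R <= 16 * (expR c * (M.+1 ^ 2)%:R) ^+ k.
Proof.
have ec : 1 <= expR c by rewrite -expR0 ler_expR ltW.
rewrite /blocks; case: ifP => [kk|_]; last first.
  rewrite inE => /eqP ->.
  apply: (@le_trans _ _ (2 ^ (2 * k).+1)%:R).
    rewrite ler_nat -[X in (_ <= _ ^ X)%N](size_nseq _ 1%N) cf_denominator_le_expn//.
    - by apply/allP => a; rewrite mem_nseq => /andP[_ /eqP ->].
    - by apply/allP => a; rewrite mem_nseq => /andP[_ /eqP ->].
  rewrite expnS natrM expnM natrX; apply: ler_pM => //.
    by rewrite ler_nat.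
  apply: lerXn2r; rewrite ?nnegrE ?mulr_ge0 ?expR_ge0//.
  apply: (@le_trans _ _ (1 * (M.+1 ^ 2)%:R)); last by rewrite ler_wpM2r.
  by rewrite mul1r ler_nat leq_sqr; lia.
have k0' : (0 < k)%N by lia.
move=> /(jump_blocksP _ _ k0')[n [v [-> n0 /bounded_wordsP[sv pv vM] _ nE]]].
apply: le_trans (den_jump_block _ _ _ k0' n0 pv nE) _.
rewrite -mulrA ler_wpM2l// exprMn; apply: ler_pM; rewrite ?(ltW (E_gt0 k))//.
  by rewrite /E mulrC expRM_natl.
rewrite -natrX ler_nat; apply: leq_trans (cf_denominator_le_expn _ _ pv vM) _.
by rewrite sv -expnM leq_pexp2l//; lia.
Qed.

Lemma sum_blocks_ge s k : 0 <= s -> (k0 <= k)%N ->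
  E k / (2 * k%:R) * (16 * E k) `^ (- (2 * s)) * bounded_sum R s M (2 * k - 2) <=
  \sum_(w <- blocks k) weight R s w.
Proof.
move=> s0 kk; have k0' : (0 < k)%N by lia.
have kR : 0 < k%:R :> R by rewrite ltr0n.
have E16 : 0 < 16 * E k by rewrite mulr_gt0.
rewrite /blocks kk /jump_blocks big_allpairs_dep.
apply: (@le_trans _ _ (\sum_(i <- iota 1 (jump_count k))
    (16 * E k) `^ (- (2 * s)) * bounded_sum R s M (2 * k - 2))); last first.
  rewrite big_seq [leRHS]big_seq; apply: ler_sum => i ic.
  rewrite /bounded_sum mulr_sumr big_seq [leRHS]big_seq; apply: ler_sum => v vM.
  have : jump_block (jump_base k + i) v \in jump_blocks k.
    by apply/allpairsP; exists (i, v).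
  move=> /(jump_blocksP _ _ k0')[n [v' [/jump_block_inj[-> ->] n0 /bounded_wordsP[_ pv _] _ nE]]].
  rewrite /weight -powRM ?(ltW E16)// !powRN lef_pV2 ?posrE ?powR_gt0 ?mulr_gt0 ?ltr0n ?cf_denominator_gt0 ?all_jump_block//.
  apply: ge0_ler_powR; rewrite ?nnegrE ?mulr_ge0 ?(ltW E16) ?(ltW (E_gt0 k))//.
  exact: den_jump_block.
rewrite big_const_seq count_predT size_iota iter_addr_0 -[leRHS]mulr_natl -mulrA ler_wpM2r//.
  by rewrite mulr_ge0 ?powR_ge0// ltW// bounded_sum_gt0.
(* Truncation loses less than 1, which is at most half of [E k / k]: at least [E k / (2 k)] digits
   remain. *)
have : E k / k%:R < (jump_count k).+1%:R by exact: truncnS_gt.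
have : 1 <= E k / (2 * k%:R) by rewrite ler_pdivlMr ?mulr_gt0// mul1r k0_exp.
have -> : E k / k%:R = 2 * (E k / (2 * k%:R)) by field; rewrite gt_eqF.
by rewrite -natr1; lra.
Qed.

Let H k := if (k0 <= k)%N then E k * (1 + k%:R^-1) else 1.

(** The excess [1 + 1/m] is at most [1 + c <= e^c], the growth of [E] in one step; this is where
    [1 <= c * k0] enters. *)
Let H_homo m k : (m <= k)%N -> H m <= H k.
Proof.
move=> mk; have E1 j : 1 <= E j by rewrite /E -expR0 ler_expR mulr_ge0// ltW.
have HE j : (0 < j)%N -> 1 <= E j * (1 + j%:R^-1).
  move=> j0; have : 0 < j%:R^-1 :> R by rewrite invr_gt0 ltr0n.
  by have := E1 j; nra.
rewrite /H; case: ifP => mk0; case: ifP => kk0 //; [|by lia|by apply: HE; lia].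
have [->//|nmk] := eqVneq m k.
have m0 : 0 < m%:R :> R by rewrite ltr0n; lia.
apply: (@le_trans _ _ (E k)); last first.
  by rewrite ler_peMr ?(ltW (E_gt0 k))// lerDl invr_ge0.
apply: (@le_trans _ _ (E m * expR c)).
  rewrite ler_wpM2l ?(ltW (E_gt0 m))//; apply: le_trans (expR_ge1Dx _).
  rewrite lerD2l -[leLHS]mul1r ler_pdivrMr//; apply: (le_trans k0_c).
  by rewrite ler_wpM2l ?(ltW c_gt0)// ler_nat.
rewrite /E -expRD ler_expR -[X in _ + X]mulr1 -mulrDr ler_wpM2l ?(ltW c_gt0)//.
by rewrite natr1 ler_nat; lia.
Qed.

Lemma blocks_products k w : w \in blocks k -> [/\ nth 0%N w (2 * k) = 1%N,
  (nth 0%N w 0)%:R <= H k &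
  forall j, (j < 2 * k)%N -> (nth 0%N w j * nth 0%N w j.+1)%:R <= H k].
Proof.
rewrite /blocks /H; case: ifP => [kk|_]; last first.
  rewrite inE => /eqP ->; split => [|//|j jk]; rewrite !nth_nseq ?ltnSn//.
  by rewrite !ifT//; lia.
have k0' : (0 < k)%N by lia.
move=> /(jump_blocksP _ _ k0')[n [v [-> n0 /bounded_wordsP[sv pv vM] _ nE]]].
have kE : (2 * k = (size v).+2)%N by rewrite sv; lia.
split; first by rewrite kE /= nth_rcons ltnn eqxx.
  exact: nE.
case=> [_|j jk]; first by rewrite /= muln1.
have dM i : (nth 0%N (1%N :: rcons v 1%N) i <= M)%N.
  have [h|h] := ltnP i (size (1%N :: rcons v 1%N)); last by rewrite nth_default.
  have /allP : all (geq M) (1%N :: rcons v 1%N) by rewrite /= all_rcons /= M_gt0.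
  by apply; exact: mem_nth.
apply: (@le_trans _ _ (M ^ 2)%:R).
  by rewrite ler_nat -mulnn; apply: leq_mul; [exact: dM|exact: dM j.+1].
apply: (le_trans k0_M); apply: (@le_trans _ _ (E k)).
  by rewrite ler_expR ler_wpM2l ?(ltW c_gt0)// ler_nat.
by rewrite ler_peMr ?(ltW (E_gt0 k))// lerDl invr_ge0.
Qed.

Lemma concat_blocks_product b k i : is_branch _ blocks b ->
  (i.+1 < k.+1 ^ 2)%N -> (concat_blocks b i * concat_blocks b i.+1)%:R <= H k.
Proof.
move=> bB ik; have sb m : size (b m) = (2 * m).+1 by exact: blocks_size (bB m).
have [m [j [jm iE]]] := nat_square_split i.
have [last1 _ prods] := blocks_products m _ (bB m).
have [jm'|jm'] := ltnP j (2 * m).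
  rewrite iE -addnS !concat_blocks_block//.
  by apply: le_trans (prods j jm') (H_homo _ _ _); nia.
have -> : concat_blocks b i = 1%N.
  rewrite iE concat_blocks_block//.
  by have -> : j = (2 * m)%N by lia.
have -> : (i.+1 = m.+1 ^ 2 + 0)%N by rewrite iE; nia.
have [_ h _] := blocks_products m.+1 _ (bB m.+1).
rewrite concat_blocks_block// mul1n; apply: (le_trans h); apply: H_homo; nia.
Qed.

Lemma branch_max_consecutive_product b (x : R) k n : is_branch _ blocks b ->
  cf_expansion x (concat_blocks b) -> (k0 <= k)%N -> (k ^ 2 <= n < k.+1 ^ 2)%N ->
  E k <= (max_consecutive_product x n)%:R <= E k * (1 + k%:R^-1).
Proof.
move=> bB xb kk /andP[kn nk]; have k0' : (0 < k)%N by lia.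
have sb m : size (b m) = (2 * m).+1 by exact: blocks_size (bB m).
rewrite /max_consecutive_product (partial_quotientP _ _ _ xb); apply/andP; split.
  (* The lower bound comes from the final 1 of block [k - 1] times the large digit opening block
     [k]. *)
  have in_n : (k ^ 2 - 1 < n)%N by nia.
  apply: (@le_trans _ _ (concat_blocks b (k ^ 2 - 1) * concat_blocks b (k ^ 2 - 1).+1)%N%:R);
    last first.
    rewrite ler_nat.
    exact: (@leq_bigmax _ (fun i : 'I_n => concat_blocks b i * concat_blocks b i.+1)%N (Ordinal in_n)).
  have -> : ((k ^ 2 - 1).+1 = k ^ 2 + 0)%N by nia.
  have -> : (k ^ 2 - 1 = k.-1 ^ 2 + 2 * k.-1)%N by nia.
  rewrite !concat_blocks_block//.
  have [-> _ _] := blocks_products k.-1 _ (bB k.-1).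
  have := bB k; rewrite /blocks kk => /(jump_blocksP _ _ k0')[m [v [-> _ _ Em _]]].
  by rewrite mul1n /= ltW.
have HE : H k = E k * (1 + k%:R^-1) by rewrite /H kk.
have H0 : 0 <= H k by rewrite HE mulr_ge0 ?addr_ge0 ?invr_ge0// ltW.
rewrite -HE; have /andP[h _] := truncn_itv H0; apply: le_trans h; rewrite ler_nat.
apply/bigmax_leqP => i _; rewrite truncn_ge_nat//.
by apply: concat_blocks_product => //; apply: leq_ltn_trans nk; exact: ltn_ord.
Qed.

Lemma branch_L_set b (x : R) : is_branch _ blocks b -> cf_expansion x (concat_blocks b) ->
  L_set psi x.
Proof.
move=> bB xb; split; [exact: cf_expansion_itv xb|exact: cf_expansion_irrational xb|].
apply/cvgrPdist_le => e e0.
pose K := (k0 + (Num.truncn e^-1).+1)%N.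
exists (K ^ 2)%N => // n /= Kn.
have [k [j [jk nE]]] := nat_square_split n.
have Kk : (K <= k)%N by nia.
have kk0 : (k0 <= k)%N by rewrite /K in Kk; lia.
have kn : (k ^ 2 <= n < k.+1 ^ 2)%N by nia.
have n1 : (1 <= n)%N by nia.
rewrite (psiE _ _ _ c_gt0 ln_psi k n n1 kn).
have /andP[h1 h2] := branch_max_consecutive_product b x k n bB xb kk0 kn.
have k1 : e^-1 <= k%:R.
  by apply: (le_trans (ltW (truncnS_gt _))); rewrite ler_nat; apply: leq_trans Kk; rewrite /K leq_addl.
have k1' : k%:R^-1 <= e.
  by rewrite -[e]invrK lef_pV2 ?posrE ?invr_gt0// ltr0n; lia.
have := E_gt0 k => Ek.
rewrite distrC ler_norml -/(E k); apply/andP; split.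
  rewrite lerBrDr ler_pdivlMr//; apply: le_trans h1; nra.
by rewrite lerBlDr ler_pdivrMr//; nra.
Qed.

End blocks.

End lower_bound.

(** * Growth of the block sums below the root, and the dimension formula *)

Section dimension.
Variables (R : realType) (c : R) (psi : nat -> R).
Hypothesis c_gt0 : 0 < c.
Hypothesis ln_psi : forall n : nat, (1 <= n)%N ->
  ln (psi n) = c * (Num.floor (Num.sqrt (n%:R : R)))%:~R.
Implicit Types (s t C x : R) (k : nat).

(** For sets of diameter at most 1 a smaller exponent only increases the cost, so a bound at [s]
    serves all [t] below. *)
Lemma hausdorff_measure_neq0 (A : set R) s t C : 0 < s -> 0 <= t -> t <= s -> 0 < C ->
  (forall U : nat -> set R, A `<=` \bigcup_i U i ->
    (C%:E <= \sum_(0 <= i <oo) diameter_pow s (U i))%E) ->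
  hausdorff_measure t A <> 0%E.
Proof.
move=> s0 t0 ts C0 HC H0.
suff : (C%:E <= hausdorff_premeasure t 1 A)%E.
  apply/negP; rewrite -ltNge; apply: (@le_lt_trans _ _ 0%E); last by rewrite lte_fin.
  by rewrite -H0; apply: ereal_sup_ubound; exists 1 => //=.
apply: le_ereal_inf_tmp => _ [U [AU dU] <-]; apply: (le_trans (HC U AU)).
apply: lee_nneseries => [i _ _|i _]; first exact: diameter_pow_ge0.
rewrite /diameter_pow; case: eqP => // /eqP/set0P[x Ux].
have d0 : (0 <= diameter (U i))%E.
  by apply: ereal_sup_ubound; exists x => //; exists x => //; rewrite subrr normr0.
move: d0 (dU i); case: (diameter (U i)) => // d; rewrite !poweR_EFin !lee_fin => d0 d1.
move: d0; rewrite le_eqVlt => /predU1P[<-|d0].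
  by rewrite powR0 ?powR_ge0// gt_eqF.
by apply: ger_powR => //; rewrite d0.
Qed.

Lemma natr_unbounded x : exists n, x <= n%:R.
Proof. by exists (Num.truncn x).+1; exact/ltW/truncnS_gt. Qed.

Lemma exists_block_start (M : nat) : exists k0, [/\ (0 < k0)%N, 1 <= c * k0%:R,
  (M ^ 2)%:R <= expR (c * k0%:R) &
  forall k, (k0 <= k)%N -> 2 * k%:R <= expR (c * k%:R)].
Proof.
have [k1 h1] := natr_unbounded c^-1.
have [k2 h2] := natr_unbounded ((M ^ 2)%:R / c).
(* From [e^(ck) >= (1 + c k / 2)^2 >= c^2 k^2 / 4], which is at least [2 k] once [k >= 8 / c^2]. *)
have [k3 h3] := natr_unbounded (8 / c ^+ 2).
exists (k1 + k2 + k3).+1.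
have mono (j k : nat) x : x <= j%:R -> (j <= k)%N -> x <= k%:R.
  by move=> xj jk; apply: (le_trans xj); rewrite ler_nat.
split => //.
- by rewrite mulrC -ler_pdivrMr// div1r; apply: (mono k1) => //; lia.
- apply: le_trans (expR_ge1Dx _).
  have : (M ^ 2)%:R / c <= (k1 + k2 + k3).+1%:R by apply: (mono k2) => //; lia.
  by rewrite ler_pdivrMr// mulrC; lra.
move=> k kk.
have : 8 / c ^+ 2 <= k%:R by apply: (mono k3) => //; lia.
rewrite ler_pdivrMr ?exprn_gt0// => h.
have -> : expR (c * k%:R) = expR (c * k%:R / 2) ^+ 2.
  by rewrite -expRM_natl; congr expR; field.
have : 1 + c * k%:R / 2 <= expR (c * k%:R / 2) by exact: expR_ge1Dx.
have : 0 <= c * k%:R by rewrite mulr_ge0// ltW.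
have : 0 <= k%:R :> R by [].
move: (k%:R) (expR _) h => K X h K0 cK0 hX.
have : (1 + c * K / 2) ^+ 2 <= X ^+ 2 by apply: lerXn2r; rewrite ?nnegrE//; lra.
apply: le_trans.
have : 0 <= (K * c ^+ 2 - 8) * K by rewrite mulr_ge0// subr_ge0.
rewrite !expr2; nra.
Qed.

(** Up to constants the block sum is at least [e^(2 k delta) / k], where [delta] is the gap between
    [beta] and the line. Bounding [e^(k delta)] below by [k delta], twice, leaves linear growth,
    which suffices. *)
Lemma sum_blocks_growth s : 1 / 2 < s -> c * (s - 1 / 2) < rpressure s ->
  exists M k0 (eta : R), [/\ (0 < M)%N, 0 < eta, [/\ (0 < k0)%N, 1 <= c * k0%:R,
    (M ^ 2)%:R <= expR (c * k0%:R) &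
    forall k, (k0 <= k)%N -> 2 * k%:R <= expR (c * k%:R)] &
  forall k, (k0 <= k)%N -> eta * k%:R <= \sum_(w <- blocks R c M k0 k) weight R s w].
Proof.
move=> s2 sP; have cs : 0 < c * (s - 1 / 2) by rewrite mulr_gt0// subr_gt0.
pose beta := (rpressure s + c * (s - 1 / 2)) / 2.
have [M [kappa [M0 kap0 growth]]] : exists M (kappa : R), [/\ (0 < M)%N, 0 < kappa &
    forall n, kappa * expR (n%:R * beta) <= bounded_sum R s M n].
  by apply: bounded_sum_growth => //; rewrite /beta; lra.
have [k0 k0P] := exists_block_start M.
pose delta := beta - c * (s - 1 / 2).
have d0 : 0 < delta by rewrite /delta /beta; lra.
pose eta := kappa * 16 `^ (- (2 * s)) * expR (- (2 * beta)) * delta / 2 * delta.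
have eta0 : 0 < eta by rewrite !(mulr_gt0, divr_gt0) ?expR_gt0 ?powR_gt0.
exists M, k0, eta; split => // k kk.
have [k00 k0c k0M k0e] := k0P.
have s0 : 0 <= s by lra.
apply: le_trans (sum_blocks_ge R c c_gt0 M k0 M0 k00 k0c k0M k0e s k s0 kk).
have k_gt0 := leq_trans k00 kk.
have kR : 0 < k%:R :> R by rewrite ltr0n.
apply: (@le_trans _ _ (expR (c * k%:R) / (2 * k%:R) *
    (16 * expR (c * k%:R)) `^ (- (2 * s)) * (kappa * expR ((2 * k - 2)%:R * beta)))); last first.
  by rewrite ler_wpM2l// mulr_ge0 ?powR_ge0// divr_ge0 ?expR_ge0// mulr_ge0.
rewrite powRM ?expR_ge0// -expRM.
have -> : (2 * k - 2)%:R = 2 * k%:R - 2 :> R by rewrite natrB ?natrM// leq_pmulr.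
set P := 16 `^ _.
have P0 : 0 < P by rewrite powR_gt0.
have -> : expR (c * k%:R) / (2 * k%:R) * (P * expR (c * k%:R * - (2 * s))) *
     (kappa * expR ((2 * k%:R - 2) * beta)) =
   kappa * P / 2 / k%:R *
     (expR (c * k%:R) * expR (c * k%:R * - (2 * s)) * expR ((2 * k%:R - 2) * beta)).
  by field; rewrite gt_eqF.
have -> : expR (c * k%:R) * expR (c * k%:R * - (2 * s)) * expR ((2 * k%:R - 2) * beta)
   = expR (- (2 * beta)) * (expR (k%:R * delta) * expR (k%:R * delta)).
  by rewrite -!expRD; congr expR; rewrite /delta; field.
have ex : k%:R * delta <= expR (k%:R * delta).
  by apply: le_trans (expR_ge1Dx _); lra.
have kd0 : 0 <= k%:R * delta by rewrite mulr_ge0// ltW.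
have ex2 : k%:R * delta * (k%:R * delta) <= expR (k%:R * delta) * expR (k%:R * delta).
  exact: ler_pM.
have B0 := expR_gt0 (- (2 * beta)).
have -> : eta * k%:R = kappa * P / 2 / k%:R * (expR (- (2 * beta)) * (k%:R * delta * (k%:R * delta))).
  by rewrite /eta -/P; field; rewrite gt_eqF.
rewrite ler_wpM2l//; first by rewrite !(mulr_ge0, divr_ge0)// ltW.
by rewrite ler_wpM2l// ltW.
Qed.

Lemma hausdorff_measure_L_set_neq0 s t : 1 / 2 < s -> c * (s - 1 / 2) < rpressure s ->
  0 <= t -> t <= s -> hausdorff_measure t (L_set psi) <> 0%E.
Proof.
move=> s2 sP t0 ts; have s0 : 0 < s by lra.
have [M [k0 [eta [M0 eta0 [k00 k0c k0M k0e] HS]]]] := sum_blocks_growth s s2 sP.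
pose rho := expR c * (M.+1 ^ 2)%:R.
have rho1 : 1 <= rho.
  by rewrite mulr_ege1 ?ler1n ?expn_gt0// -expR0 ler_expR ltW.
pose B := blocks R c M k0.
have Bpos := blocks_pos R c c_gt0 M k0 M0 k00 k0c k0M.
have Bsize := blocks_size R c c_gt0 M k0 M0 k00 k0c k0M.
have Bden := blocks_den R c c_gt0 M k0 M0 k00 k0c k0M.
have Buniq := blocks_uniq R c M k0.
have S_gt0 k : 0 < \sum_(w <- B k) weight R s w.
  have [kk|kk] := leqP k0 k.
    by apply: lt_le_trans (HS k kk); rewrite mulr_gt0// ltr0n (leq_trans k00 kk).
  rewrite /B /blocks leqNgt kk /= big_seq1; apply: weight_gt0.
  by rewrite /= all_nseq orbT.
have S_large : exists k1, forall k, (k1 <= k)%N ->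
    2 * 4 `^ s * (rho ^+ 5) `^ s <= \sum_(w <- B k) weight R s w.
  have [k1 hk1] := natr_unbounded (2 * 4 `^ s * (rho ^+ 5) `^ s / eta).
  exists (k0 + k1)%N => k kk; apply: le_trans (HS k (leq_trans (leq_addr _ _) kk)).
  rewrite -ler_pdivrMl// mulrC; apply: (le_trans hk1).
  by rewrite ler_nat (leq_trans (leq_addl _ _) kk).
have [C C0 HC] := block_mass_distribution R B s 16 rho Buniq Bpos Bsize Bden
  (ler1n _ 16) rho1 s0 S_gt0 S_large.
apply: (hausdorff_measure_neq0 _ s t C^-1) => //; first by rewrite invr_gt0.
move=> U AU; apply: HC => b bB.
have xb := block_pointP R B Bpos Bsize b bB.
have [i _ Ui] := AU _ (branch_L_set R c psi c_gt0 ln_psi M k0 M0 k00 k0c k0M b _ bB xb).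
by exists i.
Qed.

End dimension.

Theorem theorem1p5 (R : realType) (c : R) (psi : nat -> R)
  (hc : 0 < c)
  (hpsi : forall n : nat, (1 <= n)%N ->
     ln (psi n) = c * (Num.floor (Num.sqrt (n%:R : R)))%:~R) :
  exists2 theta : R,
    unique (fun t : R => 1 / 2 < t /\ pressure t = (c * (t - 1 / 2))%:E) theta
    & hausdorff_dim (L_set psi) = theta%:E.
Proof.
have [theta theta2 thetaP] := rpressure_root R c hc.
exists theta.
  split=> [|t [t2 tP]]; first by rewrite pressureE// thetaP.
  move: tP; rewrite pressureE// => -[tP]; apply/eqP; rewrite eq_le !leNgt.
  apply/andP; split; apply/negP => lt_t.
  - by have := rpressure_antitone R _ _ t2 (ltW lt_t); rewrite thetaP tP; nra.
  - by have := rpressure_antitone R _ _ theta2 (ltW lt_t); rewrite thetaP tP; nra.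
apply/eqP; rewrite eq_le; apply/andP; split.
  apply/lee_addgt0Pr => e e0; apply: ereal_inf_lbound.
  exists (theta + e) => //; split; first by lra.
  apply: (hausdorff_measure_L_set R c psi hc hpsi); first by lra.
  apply: (@le_lt_trans _ _ (rpressure theta)).
    by apply: rpressure_antitone => //; lra.
  by rewrite thetaP ltr_pM2l//; lra.
apply: le_ereal_inf_tmp => _ [t [t0 Ht] <-]; rewrite lee_fin leNgt; apply/negP => t_lt.
pose s := Num.max t ((theta + 1 / 2) / 2).
have s_lt : s < theta by rewrite gt_max t_lt/=; lra.
have s2 : 1 / 2 < s by rewrite lt_max; apply/orP; right; lra.
have ts : t <= s by rewrite le_max lexx.
apply: (hausdorff_measure_L_set_neq0 R c psi hc hpsi s t s2 _ t0 ts Ht).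
apply: (@lt_le_trans _ _ (rpressure theta)).
  by rewrite thetaP ltr_pM2l//; lra.
by apply: rpressure_antitone => //; exact: ltW.
Qed.
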